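(* Let $X$ be a real nonzero Banach space and $S,T:X\rightrightarrows X^*$ maximal monotone operators of Gossez type (D) with strong representative functions $h_S,h_T$ such that $\operatorname{pr}_{X^*}(\operatorname{dom}h_S)\cap\operatorname{pr}_{X^*}(\operatorname{dom}h_T)\neq\emptyset$. Then (a) ${}^{ic}(R(S)-R(T))\subseteq{}^{ic}(\operatorname{co}R(S)-\operatorname{co}R(T))\subseteq{}^{ic}\big(\operatorname{pr}_{X^*}(\operatorname{dom}h_S)-\operatorname{pr}_{X^*}(\operatorname{dom}h_T)\big)=\operatorname{ri}\big(\operatorname{pr}_{X^*}(\operatorname{dom}h_S)-\operatorname{pr}_{X^*}(\operatorname{dom}h_T)\big)$; (b) if $0\in{}^{ic}(R(S)-R(T))$ or $0\in{}^{ic}(\operatorname{co}R(S)-\operatorname{co}R(T))$, then $\overline S\|\overline T$ is maximal monotone of Gossez type (D).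
   Context: $X$ identified with its image in $X^{**}$. $G,R$ graph and range; $\operatorname{co}$ convex hull. Coupling $c(x,x^* )=\langle x^*,x\rangle$. Conjugate of $h$ on $X\times X^*$: $h^*(x^*,x^{**})=\sup_{(x,y^* )}\{\langle x^*,x\rangle+\langle x^{**},y^*\rangle-h(x,y^* )\}$. Representative function of monotone $S$: convex norm-lsc $h_S$ with $h_S\ge c$ and $G(S)\subseteq\{h_S=c\}$; strong if $h_S^*(x^*,x^{**})\ge\langle x^{**},x^*\rangle$ for all. Gossez's closure $\overline S:X^{**}\rightrightarrows X^*$ has graph $\{(x^{**},x^* ):\langle x^{**}-y,x^*-y^*\rangle\ge0\ \forall(y,y^* )\in G(S)\}$; maximal monotone $S$ is of Gossez type (D) if each point of $G(\overline S)$ is the $w^*\times\|\cdot\|_*$-limit of a bounded net in $G(S)$. $\overline S\|\overline T(x)=(\overline S^{-1}+\overline T^{-1})^{-1}(x)$ for $x\in X$. $\operatorname{icr}D=\{u:\forall x\in\operatorname{aff}(D-D)\ \exists\delta>0\ \forall\lambda\in[0,\delta]:u+\lambda x\in D\}$; ${}^{ic}D=\operatorname{icr}D$ if $\operatorname{aff}D$ closed, else $\emptyset$; $\operatorname{ri}D$ = interior relative to $\operatorname{aff}D$ if closed, else $\emptyset$. *)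

(* Defs.v *)
From Stdlib Require Import Reals Lra ClassicalEpsilon.
Open Scope R_scope.
Set Implicit Arguments.
Unset Strict Implicit.

Record Banach := mkBanach {
  B :> Type;
  bzero : B;
  badd : B -> B -> B;
  bopp : B -> B;
  bscal : R -> B -> B;
  bnorm : B -> R;
  badd_assoc : forall x y z, badd x (badd y z) = badd (badd x y) z;
  badd_comm : forall x y, badd x y = badd y x;
  badd_0 : forall x, badd x bzero = x;
  badd_opp : forall x, badd x (bopp x) = bzero;
  bscal_assoc : forall a b x, bscal a (bscal b x) = bscal (a * b) x;
  bscal_1 : forall x, bscal 1 x = x;
  bscal_distr_l : forall a x y, bscal a (badd x y) = badd (bscal a x) (bscal a y);
  bscal_distr_r : forall a b x, bscal (a + b) x = badd (bscal a x) (bscal b x);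
  bnorm_nonneg : forall x, 0 <= bnorm x;
  bnorm_eq0 : forall x, bnorm x = 0 -> x = bzero;
  bnorm_scal : forall a x, bnorm (bscal a x) = Rabs a * bnorm x;
  bnorm_triangle : forall x y, bnorm (badd x y) <= bnorm x + bnorm y;
  bcomplete : forall u : nat -> B,
    (forall eps, 0 < eps -> exists N, forall n m, (N <= n)%nat -> (N <= m)%nat ->
        bnorm (badd (u n) (bopp (u m))) < eps) ->
    exists l, forall eps, 0 < eps -> exists N, forall n, (N <= n)%nat ->
        bnorm (badd (u n) (bopp l)) < eps
}.

Arguments bzero {_}.
Arguments badd {_} _ _.
Arguments bopp {_} _.
Arguments bscal {_} _ _.
Arguments bnorm {_} _.

Definition bminus (X : Banach) (x y : X) : X := badd x (bopp y).

Record dual (X : Banach) := mkDual {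
  dapp :> X -> R;
  dapp_add : forall x y, dapp (badd x y) = dapp x + dapp y;
  dapp_scal : forall a x, dapp (bscal a x) = a * dapp x;
  dapp_bnd : exists M, forall x, Rabs (dapp x) <= M * bnorm x
}.

Section DualOps.
Variable X : Banach.

Lemma dzero_bnd : exists M, forall x : X, Rabs 0 <= M * bnorm x.
Proof. exists 0; intro x; rewrite Rabs_R0, Rmult_0_l; lra. Qed.

Definition dzero : dual X :=
  @mkDual X (fun _ => 0) (fun _ _ => ltac:(lra)) (fun _ _ => ltac:(lra)) dzero_bnd.

Lemma dplus_add (f g : dual X) :
  forall x y, f (badd x y) + g (badd x y) = (f x + g x) + (f y + g y).
Proof. intros; rewrite !dapp_add; ring. Qed.
Lemma dplus_scal (f g : dual X) :
  forall a x, f (bscal a x) + g (bscal a x) = a * (f x + g x).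
Proof. intros; rewrite !dapp_scal; ring. Qed.
Lemma dplus_bnd (f g : dual X) :
  exists M, forall x, Rabs (f x + g x) <= M * bnorm x.
Proof.
  destruct (dapp_bnd f) as [M1 H1]; destruct (dapp_bnd g) as [M2 H2].
  exists (M1 + M2); intro x; rewrite Rmult_plus_distr_r.
  pose proof (Rabs_triang (f x) (g x)); pose proof (H1 x); pose proof (H2 x); lra.
Qed.
Definition dplus (f g : dual X) : dual X :=
  @mkDual X (fun x => f x + g x) (dplus_add f g) (dplus_scal f g) (dplus_bnd f g).

Lemma dscale_add (a : R) (f : dual X) :
  forall x y, a * f (badd x y) = a * f x + a * f y.
Proof. intros; rewrite dapp_add; ring. Qed.
Lemma dscale_scal (a : R) (f : dual X) :
  forall b x, a * f (bscal b x) = b * (a * f x).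
Proof. intros; rewrite dapp_scal; ring. Qed.
Lemma dscale_bnd (a : R) (f : dual X) :
  exists M, forall x, Rabs (a * f x) <= M * bnorm x.
Proof.
  destruct (dapp_bnd f) as [M H].
  exists (Rabs a * M); intro x; rewrite Rabs_mult, Rmult_assoc.
  apply Rmult_le_compat_l; [apply Rabs_pos | apply H].
Qed.
Definition dscale (a : R) (f : dual X) : dual X :=
  @mkDual X (fun x => a * f x) (dscale_add a f) (dscale_scal a f) (dscale_bnd a f).

Definition dminus (f g : dual X) : dual X := dplus f (dscale (-1) g).

Definition dbounds (f : dual X) (M : R) : Prop :=
  0 <= M /\ forall x, Rabs (f x) <= M * bnorm x.
Definition is_inf (E : R -> Prop) (m : R) : Prop :=
  (forall y, E y -> m <= y) /\ (forall m', (forall y, E y -> m' <= y) -> m' <= m).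
Definition dnorm (f : dual X) : R :=
  epsilon (inhabits 0) (fun m => is_inf (dbounds f) m).

Lemma dnorm_spec (f : dual X) : is_inf (dbounds f) (dnorm f).
Proof.
  unfold dnorm; apply epsilon_spec.
  destruct (dapp_bnd f) as [M HM].
  assert (HB : dbounds f (Rmax M 0)).
  { split; [apply Rmax_r|]. intro x. eapply Rle_trans; [apply HM|].
    apply Rmult_le_compat_r; [apply bnorm_nonneg | apply Rmax_l]. }
  destruct (completeness (fun y => dbounds f (- y))) as [l [Hub Hl]].
  - exists 0; intros y [Hy _]; lra.
  - exists (- Rmax M 0); now rewrite Ropp_involutive.
  - exists (- l); split.
    + intros y Hy. assert (- y <= l) by (apply Hub; now rewrite Ropp_involutive). lra.
    + intros m' Hm'. assert (l <= - m').
      { apply Hl. intros y Hy. specialize (Hm' _ Hy). lra. }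
      lra.
Qed.

Lemma dnorm_bound (f : dual X) (x : X) : Rabs (f x) <= dnorm f * bnorm x.
Proof.
  destruct (dnorm_spec f) as [Hlb Hglb].
  destruct (dapp_bnd f) as [M HM].
  destruct (Req_dec (bnorm x) 0) as [H0|H0].
  - specialize (HM x); rewrite H0, Rmult_0_r in HM |- *; exact HM.
  - assert (Hpos : 0 < bnorm x) by (pose proof (bnorm_nonneg x); lra).
    assert (Rabs (f x) / bnorm x <= dnorm f).
    { apply Hglb. intros y [Hy0 Hy].
      apply (Rmult_le_reg_r (bnorm x)); [exact Hpos|].
      unfold Rdiv; rewrite Rmult_assoc, Rinv_l by lra; rewrite Rmult_1_r; apply Hy. }
    apply (Rmult_le_compat_r (bnorm x)) in H; [|lra].
    unfold Rdiv in H; rewrite Rmult_assoc, Rinv_l, Rmult_1_r in H by lra; exact H.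
Qed.

End DualOps.

Record bidual (X : Banach) := mkBidual {
  bdapp :> dual X -> R;
  bdapp_add : forall f g, bdapp (dplus f g) = bdapp f + bdapp g;
  bdapp_scal : forall a f, bdapp (dscale a f) = a * bdapp f;
  bdapp_bnd : exists M, forall f, Rabs (bdapp f) <= M * dnorm f
}.

Section BidualOps.
Variable X : Banach.

Lemma J_bnd (x : X) : exists M, forall f : dual X, Rabs (f x) <= M * dnorm f.
Proof. exists (bnorm x); intro f; rewrite Rmult_comm; apply dnorm_bound. Qed.
Definition J (x : X) : bidual X :=
  @mkBidual X (fun f => f x) (fun _ _ => eq_refl) (fun _ _ => eq_refl) (J_bnd x).

Lemma bplus_add (F G : bidual X) :
  forall f g, F (dplus f g) + G (dplus f g) = (F f + G f) + (F g + G g).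
Proof. intros; rewrite !bdapp_add; ring. Qed.
Lemma bplus_scal (F G : bidual X) :
  forall a f, F (dscale a f) + G (dscale a f) = a * (F f + G f).
Proof. intros; rewrite !bdapp_scal; ring. Qed.
Lemma bplus_bnd (F G : bidual X) :
  exists M, forall f, Rabs (F f + G f) <= M * dnorm f.
Proof.
  destruct (bdapp_bnd F) as [M1 H1]; destruct (bdapp_bnd G) as [M2 H2].
  exists (M1 + M2); intro f; rewrite Rmult_plus_distr_r.
  pose proof (Rabs_triang (F f) (G f)); pose proof (H1 f); pose proof (H2 f); lra.
Qed.
Definition bplus (F G : bidual X) : bidual X :=
  @mkBidual X (fun f => F f + G f) (bplus_add F G) (bplus_scal F G) (bplus_bnd F G).

End BidualOps.

Definition multifun (X : Banach) := X -> dual X -> Prop.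

Definition monotone (X : Banach) (S : multifun X) : Prop :=
  forall x xs y ys, S x xs -> S y ys -> 0 <= (dminus xs ys) (bminus x y).

Definition maximal_monotone (X : Banach) (S : multifun X) : Prop :=
  monotone S /\
  forall S' : multifun X, monotone S' -> (forall x xs, S x xs -> S' x xs) ->
    forall x xs, S' x xs -> S x xs.

(* Gossez's closure: graph of \overline S : X^** ⇉ X^*,
   <xss - y, xs - ys> = xss(xs - ys) - (xs - ys)(y) *)
Definition gossez (X : Banach) (S : multifun X) (xss : bidual X) (xs : dual X) : Prop :=
  forall y ys, S y ys -> 0 <= xss (dminus xs ys) - (dminus xs ys) y.

Definition directed (I : Type) (le : I -> I -> Prop) : Prop :=
  inhabited I /\ (forall i, le i i) /\ (forall i j k, le i j -> le j k -> le i k) /\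
  (forall i j, exists k, le i k /\ le j k).

Definition net_conv (I : Type) (le : I -> I -> Prop) (u : I -> R) (l : R) : Prop :=
  forall eps, 0 < eps -> exists i0, forall i, le i0 i -> Rabs (u i - l) < eps.

Definition gossez_D (X : Banach) (S : multifun X) : Prop :=
  maximal_monotone S /\
  forall (xss : bidual X) (xs : dual X), gossez S xss xs ->
    exists (I : Type) (le : I -> I -> Prop) (x : I -> X) (ys : I -> dual X),
      directed le /\
      (forall i, S (x i) (ys i)) /\
      (exists M, forall i, bnorm (x i) <= M /\ dnorm (ys i) <= M) /\
      (forall f : dual X, net_conv le (fun i => f (x i)) (xss f)) /\
      net_conv le (fun i => dnorm (dminus (ys i) xs)) 0.

(* \overline S || \overline T (x) = (\overline S^{-1} + \overline T^{-1})^{-1}(x), x in X *)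
Definition parallel_sum (X : Banach) (S T : multifun X) : multifun X :=
  fun x xs => exists a b : bidual X, gossez S a xs /\ gossez T b xs /\ J x = bplus a b.

(* Extended reals (-oo not needed for functions valued in R ∪ {+oo})   *)
Inductive ERbar := Fin (r : R) | PInf.

Definition ERle (a b : ERbar) : Prop :=
  match a, b with
  | _, PInf => True
  | PInf, Fin _ => False
  | Fin r, Fin s => r <= s
  end.
Definition ERlt (a b : ERbar) : Prop :=
  match a, b with
  | Fin r, PInf => True
  | PInf, _ => False
  | Fin r, Fin s => r < s
  end.

Definition xfun (X : Banach) := X -> dual X -> ERbar.

Definition xconvex (X : Banach) (h : xfun X) : Prop :=
  forall x ys y zs a b t, h x ys = Fin a -> h y zs = Fin b -> 0 <= t <= 1 ->
    ERle (h (badd (bscal t x) (bscal (1 - t) y))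
            (dplus (dscale t ys) (dscale (1 - t) zs)))
         (Fin (t * a + (1 - t) * b)).

Definition norm_lsc (X : Banach) (h : xfun X) : Prop :=
  forall x xs r, ERlt (Fin r) (h x xs) ->
    exists d, 0 < d /\ forall y ys,
      bnorm (bminus y x) + dnorm (dminus ys xs) < d -> ERlt (Fin r) (h y ys).

Definition representative (X : Banach) (S : multifun X) (h : xfun X) : Prop :=
  xconvex h /\ norm_lsc h /\
  (forall (x : X) (xs : dual X), ERle (Fin (xs x)) (h x xs)) /\
  (forall (x : X) (xs : dual X), S x xs -> h x xs = Fin (xs x)).

(* conj_ge h xs xss a  means  h^conj(xs,xss) >= a, where
   h^conj(xs,xss) = sup over (x,ys) of { xs(x) + xss(ys) - h(x,ys) }
   (only points of dom h contribute, the others give -oo) *)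
Definition conj_ge (X : Banach) (h : xfun X) (xs : dual X) (xss : bidual X) (a : R) : Prop :=
  forall b, b < a -> exists x ys r, h x ys = Fin r /\ b < xs x + xss ys - r.

Definition strong_rep (X : Banach) (S : multifun X) (h : xfun X) : Prop :=
  representative S h /\ forall xs xss, conj_ge h xs xss (xss xs).

Definition dset (X : Banach) := dual X -> Prop.

Definition pr_dom (X : Banach) (h : xfun X) : dset X :=
  fun xs => exists x r, h x xs = Fin r.

Definition range (X : Banach) (S : multifun X) : dset X := fun xs => exists x, S x xs.

Definition set_minus (X : Banach) (A C : dset X) : dset X :=
  fun u => exists a c, A a /\ C c /\ u = dminus a c.

Definition dconvex (X : Banach) (C : dset X) : Prop :=
  forall a b t, C a -> C b -> 0 <= t <= 1 -> C (dplus (dscale t a) (dscale (1 - t) b)).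
Definition daffine (X : Banach) (C : dset X) : Prop :=
  forall a b t, C a -> C b -> C (dplus (dscale t a) (dscale (1 - t) b)).

Definition co (X : Banach) (A : dset X) : dset X :=
  fun u => forall C, dconvex C -> (forall a, A a -> C a) -> C u.
Definition aff (X : Banach) (A : dset X) : dset X :=
  fun u => forall C, daffine C -> (forall a, A a -> C a) -> C u.

Definition dclosed (X : Banach) (C : dset X) : Prop :=
  forall u, (forall eps, 0 < eps -> exists v, C v /\ dnorm (dminus v u) < eps) -> C u.

Definition icr (X : Banach) (D : dset X) : dset X :=
  fun u => forall x, aff (set_minus D D) x ->
    exists d, 0 < d /\ forall l, 0 <= l <= d -> D (dplus u (dscale l x)).

Definition ic (X : Banach) (D : dset X) : dset X :=
  fun u => dclosed (aff D) /\ icr D u.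

Definition ri (X : Banach) (D : dset X) : dset X :=
  fun u => dclosed (aff D) /\ D u /\
    exists eps, 0 < eps /\ forall v, aff D v -> dnorm (dminus v u) < eps -> D v.

Definition dsubset (X : Banach) (A C : dset X) : Prop := forall u, A u -> C u.

(* Main.v *)
(* For convex h with h >= c and h^conj >= c, where c is the duality coupling, Hahn-Banach gives
   inf h(x, xs) - xs(z) - zs(x) + zs(z) + s |x - z|^2 / 2 + |xs - zs|^2 / 2s <= 0
   for all (z, zs) and s > 0. Iterating this gives the Broendsted-Rockafellar property
   (near-contact points of h are close to contact points), hence maximality of {h = c} and
   pr(dom h) in the closure of R({h = c}). Letting s -> 0 gives property (NI), so that the convex
   hull of c restricted to the graph still has a conjugate dominating c; since a point of the
   Gossez closure minimizes this conjugate minus c, separation approximates it by contact points,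
   weakly* in the first and strongly in the second variable, with bounded first components:
   this is type (D).
   Robinson-Ursescu, applied to the projection of the product of the two epigraphs, turns the
   algebraic interior of pr(dom h_S) - pr(dom h_T) into a relative interior, and yields the
   Attouch-Brezis formula for the conjugate of the closed partial inf-convolution of h_S and h_T.
   That function is therefore again bounded below by c together with its conjugate, and its
   contact set is the parallel sum. *)
Require Import Defs.
From Stdlib Require Import Reals Lra Lia List ClassicalEpsilon.
From Stdlib Require Import FunctionalExtensionality PropExtensionality ProofIrrelevance.
From mathcomp Require classical_sets.
Open Scope R_scope.
Set Implicit Arguments.
Unset Strict Implicit.

(** Infima need not be attained here and conjugates live on [dual X] times [bidual X], so contact
    points are obtained from approximate ones by completeness. Functions are handled through their
    epigraphs, as relations [C]: the class [strong_epi] contains the epigraphs of strong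
    representative functions and, under the interior condition, the closed inf-convolution of two
    members. Part (b) thus reduces to identifying one contact set with the parallel sum. Only one
    inclusion is proved by duality; the other holds because the contact set is maximal and the
    parallel sum is monotone, and this monotonicity is where type (D) of the two operators enters. A
    point of the Gossez closure is related to contact points only, which is why type (D) is proved
    with the hull over the graph instead of [C] itself. For part (a), enlarging a nonempty set
    inside its closed affine hull cannot shrink [ic], and the density of the range puts the larger
    difference set inside that hull. *)

(** * Linear identities *)

(* Both sides of a linear identity are compared coefficientwise with respect to
   the list [env] of their atoms. *)
Inductive vexpr :=
| VVar (n : nat) | VZero | VAdd (a b : vexpr) | VOpp (a : vexpr) | VScal (r : R) (a : vexpr).

Fixpoint veval (E : Banach) (env : list E) (e : vexpr) : E :=
  match e with
  | VVar n => nth n env bzero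
  | VZero => bzero
  | VAdd a b => badd (veval env a) (veval env b)
  | VOpp a => bopp (veval env a)
  | VScal r a => bscal r (veval env a)
  end.

Fixpoint vcoef (e : vexpr) (i : nat) : R :=
  match e with
  | VVar n => if Nat.eqb n i then 1 else 0
  | VZero => 0
  | VAdd a b => vcoef a i + vcoef b i
  | VOpp a => - vcoef a i
  | VScal r a => r * vcoef a i
  end.

Fixpoint vlin (E : Banach) (env : list E) (c : nat -> R) : E :=
  match env with
  | nil => bzero
  | x :: t => badd (bscal (c O) x) (vlin t (fun i => c (S i)))
  end.

(** A recursion over [env] rather than a quantifier over indices, so that [cbn] leaves one real
    equation per atom. *)
Fixpoint vagree (E : Banach) (env : list E) (c d : nat -> R) : Prop :=
  match env with
  | nil => True
  | _ :: t => c O = d O /\ vagree t (fun i => c (S i)) (fun i => d (S i))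
  end.

Section Vec.
Variable E : Banach.
Implicit Types x y z : E.

Lemma badd_0_l x : badd bzero x = x.
Proof. now rewrite badd_comm, badd_0. Qed.

Lemma badd_swap x y z w : badd (badd x y) (badd z w) = badd (badd x z) (badd y w).
Proof.
  rewrite <- !badd_assoc; f_equal.
  now rewrite badd_assoc, (badd_comm y z), <- badd_assoc.
Qed.

Lemma badd_cancel x y z : badd x y = badd x z -> y = z.
Proof.
  intro H. rewrite <- (badd_0_l y), <- (badd_0_l z), <- (badd_opp x).
  now rewrite (badd_comm x), <- !badd_assoc, H.
Qed.

Lemma bscal_0 x : bscal 0 x = bzero.
Proof.
  apply (badd_cancel (x := bscal 0 x)).
  now rewrite <- bscal_distr_r, badd_0, Rplus_0_r.
Qed.

Lemma bscal_bzero a : bscal a bzero = bzero :> E.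
Proof. now rewrite <- (bscal_0 bzero), bscal_assoc, Rmult_0_r. Qed.

Lemma bopp_scal x : bopp x = bscal (-1) x.
Proof.
  apply (badd_cancel (x := x)). rewrite badd_opp.
  rewrite <- (bscal_1 x) at 1. rewrite <- bscal_distr_r.
  replace (1 + -1) with 0 by ring. now rewrite bscal_0.
Qed.

Lemma vlin_add env : forall c d,
  badd (vlin (E := E) env c) (vlin env d) = vlin env (fun i => c i + d i).
Proof.
  induction env as [|x t IH]; simpl; intros c d; [apply badd_0|].
  now rewrite badd_swap, IH, bscal_distr_r.
Qed.

Lemma vlin_scal env a : forall c,
  bscal a (vlin (E := E) env c) = vlin env (fun i => a * c i).
Proof.
  induction env as [|x t IH]; simpl; intros c; [apply bscal_bzero|].
  now rewrite bscal_distr_l, IH, bscal_assoc.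
Qed.

Lemma vlin_ext env : forall c d, vagree (E := E) env c d -> vlin env c = vlin env d.
Proof.
  induction env as [|x t IH]; simpl; intros c d H; [easy|].
  destruct H as [H0 H]. now rewrite H0, (IH _ _ H).
Qed.

Lemma vagree_pt env : forall c d, (forall i, c i = d i) -> vagree (E := E) env c d.
Proof. induction env; simpl; auto. Qed.

Lemma vlin_0 env : vlin (E := E) env (fun _ => 0) = bzero.
Proof. induction env as [|x t IH]; simpl; [easy|]. now rewrite IH, bscal_0, badd_0. Qed.

Lemma vlin_var env : forall n,
  nth n env bzero = vlin (E := E) env (fun i => if Nat.eqb n i then 1 else 0).
Proof.
  induction env as [|x t IH]; intros [|n]; simpl; try easy.
  - now rewrite vlin_0, bscal_1, badd_0.
  - now rewrite bscal_0, badd_0_l, IH.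
Qed.

Lemma veval_vlin env e : veval (E := E) env e = vlin env (vcoef e).
Proof.
  induction e; simpl.
  - apply vlin_var.
  - symmetry; apply vlin_0.
  - now rewrite IHe1, IHe2, vlin_add.
  - rewrite bopp_scal, IHe, vlin_scal. apply vlin_ext, vagree_pt; intro; ring.
  - now rewrite IHe, vlin_scal.
Qed.

Lemma vec_eq env e1 e2 :
  vagree (E := E) env (vcoef e1) (vcoef e2) -> veval env e1 = veval env e2.
Proof. intro H; rewrite !veval_vlin; now apply vlin_ext. Qed.

End Vec.

Ltac vmem x l :=
  lazymatch l with
  | nil => constr:(false)
  | x :: _ => constr:(true)
  | _ :: ?t => vmem x t
  end.
Ltac vatoms t l :=
  lazymatch t with
  | badd ?a ?b => let l := vatoms a l in vatoms b l
  | bminus ?a ?b => let l := vatoms a l in vatoms b l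
  | bopp ?a => vatoms a l
  | bscal _ ?a => vatoms a l
  | bzero => l
  | _ => lazymatch vmem t l with true => l | false => constr:(t :: l) end
  end.
Ltac vindex x l :=
  lazymatch l with
  | x :: _ => constr:(O)
  | _ :: ?t => let n := vindex x t in constr:(S n)
  end.
Ltac vreify t l :=
  lazymatch t with
  | badd ?a ?b => let a := vreify a l in let b := vreify b l in constr:(VAdd a b)
  | bminus ?a ?b => let a := vreify a l in let b := vreify b l in constr:(VAdd a (VOpp b))
  | bopp ?a => let a := vreify a l in constr:(VOpp a)
  | bscal ?r ?a => let a := vreify a l in constr:(VScal r a)
  | bzero => constr:(VZero)
  | _ => let n := vindex t l in constr:(VVar n)
  end.
Ltac vec :=
  lazymatch goal with
  | |- @eq ?T ?x ?y =>
    let l := vatoms x (@nil T) in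
    let l := vatoms y l in
    let e1 := vreify x l in
    let e2 := vreify y l in
    refine (@vec_eq _ l e1 e2 _); cbn [vagree vcoef Nat.eqb];
    repeat split; try ring; try (field; lra)
  end.

(** * Norm estimates and geometric series *)

Section Norm.
Variable E : Banach.
Implicit Types x y z : E.

Lemma bnorm_0 : bnorm (bzero : E) = 0.
Proof. rewrite <- (bscal_0 bzero), bnorm_scal, Rabs_R0; ring. Qed.

Lemma bnorm_opp x : bnorm (bopp x) = bnorm x.
Proof. rewrite bopp_scal, bnorm_scal, (Rabs_left (-1)) by lra; ring. Qed.

Lemma bnorm_minusC x y : bnorm (bminus x y) = bnorm (bminus y x).
Proof. rewrite <- bnorm_opp. f_equal. vec. Qed.

Lemma bnorm_minus_triangle y x z :
  bnorm (bminus x z) <= bnorm (bminus x y) + bnorm (bminus y z).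
Proof.
  replace (bminus x z) with (badd (bminus x y) (bminus y z)) by vec.
  apply bnorm_triangle.
Qed.

Lemma bnorm_le_minus x y : bnorm x <= bnorm y + bnorm (bminus x y).
Proof.
  replace x with (badd y (bminus x y)) at 1 by vec.
  apply bnorm_triangle.
Qed.

Lemma bnorm_scal_pos a x : 0 <= a -> bnorm (bscal a x) = a * bnorm x.
Proof. intro; rewrite bnorm_scal, Rabs_pos_eq; auto. Qed.

Lemma bminus_diag x : bminus x x = bzero.
Proof. vec. Qed.

Lemma bminus_diag_norm x : bnorm (bminus x x) = 0.
Proof. rewrite bminus_diag; apply bnorm_0. Qed.

Lemma bnorm_comb x y t :
  0 <= t <= 1 ->
  bnorm (badd (bscal t x) (bscal (1 - t) y)) <= t * bnorm x + (1 - t) * bnorm y.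
Proof.
  intro H. eapply Rle_trans; [apply bnorm_triangle|].
  rewrite !bnorm_scal_pos by lra. lra.
Qed.

Lemma bnorm_small_eq x y : (forall e, 0 < e -> bnorm (bminus x y) <= e) -> x = y.
Proof.
  intro H. assert (H0 : bminus x y = bzero).
  { apply bnorm_eq0. apply Rle_antisym; [|apply bnorm_nonneg].
    apply le_epsilon; intros e He; rewrite Rplus_0_l; auto. }
  replace x with (badd (bminus x y) y) by vec. rewrite H0. vec.
Qed.

Lemma half_pow_pos n : 0 < (/ 2) ^ n.
Proof. apply pow_lt; lra. Qed.

Lemma half_pow_small A e : 0 < e -> exists N, forall n, (N <= n)%nat -> A * (/ 2) ^ n < e.
Proof.
  intro He.
  assert (HA : 0 < e / (Rabs A + 1)).
  { apply Rdiv_lt_0_compat; [lra | pose proof (Rabs_pos A); lra]. }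
  destruct (pow_lt_1_zero (/ 2)) with (y := e / (Rabs A + 1)) as [N HN]; auto.
  { rewrite Rabs_pos_eq; lra. }
  exists N; intros n Hn. specialize (HN n Hn).
  rewrite Rabs_pos_eq in HN by (left; apply half_pow_pos).
  apply (Rmult_lt_compat_r (Rabs A + 1)) in HN; [|pose proof (Rabs_pos A); lra].
  unfold Rdiv in HN. rewrite Rmult_assoc, Rinv_l in HN by (pose proof (Rabs_pos A); lra).
  pose proof (Rle_abs A). pose proof (half_pow_pos n). nra.
Qed.

(** Completeness in the form shared by all iterations below: halving increments, with an explicit
    bound on the tail. *)
Lemma geometric_cauchy (u : nat -> E) A :
  (forall n, bnorm (bminus (u (S n)) (u n)) <= A * (/ 2) ^ n) ->
  exists l, forall n, bnorm (bminus (u n) l) <= 2 * A * (/ 2) ^ n.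
Proof.
  intro H.
  assert (Hm : forall n k, bnorm (bminus (u (n + k)%nat) (u n)) <= 2 * A * (/ 2) ^ n * (1 - (/ 2) ^ k)).
  { intros n k; induction k as [|k IH].
    - rewrite Nat.add_0_r, bminus_diag_norm; simpl; lra.
    - rewrite Nat.add_succ_r.
      eapply Rle_trans; [apply (bnorm_minus_triangle (u (n + k)%nat))|].
      eapply Rle_trans; [apply Rplus_le_compat; [apply H | apply IH]|].
      rewrite pow_add; simpl. right; field. }
  assert (HA : 0 <= A).
  { specialize (H O); simpl in H. pose proof (bnorm_nonneg (bminus (u 1%nat) (u O))); lra. }
  assert (Hm' : forall n k, (n <= k)%nat -> bnorm (bminus (u k) (u n)) <= 2 * A * (/ 2) ^ n).
  { intros n k Hk. replace k with (n + (k - n))%nat by lia.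
    eapply Rle_trans; [apply Hm|].
    pose proof (half_pow_pos n). pose proof (half_pow_pos (k - n)).
    assert (0 <= 2 * A * (/ 2) ^ n) by (apply Rmult_le_pos; lra). nra. }
  destruct (bcomplete (u := u)) as [l Hl].
  { intros e He. destruct (half_pow_small (4 * A) He) as [N HN].
    exists N; intros n m Hn Hm2. fold (bminus (u n) (u m)).
    eapply Rle_lt_trans; [apply (bnorm_minus_triangle (u N))|].
    rewrite (bnorm_minusC (u N)).
    pose proof (Hm' _ _ Hn); pose proof (Hm' _ _ Hm2). specialize (HN N (le_n _)). lra. }
  exists l; intro n. apply le_epsilon; intros e He.
  destruct (Hl _ He) as [N HN].
  set (k := Nat.max N n).
  specialize (HN k ltac:(unfold k; lia)). fold (bminus (u k) l) in HN.
  pose proof (Hm' n k ltac:(unfold k; lia)) as Hk.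
  rewrite bnorm_minusC in Hk.
  pose proof (bnorm_minus_triangle (u k) (u n) l). lra.
Qed.

End Norm.

(** * The dual and the product as Banach spaces *)

Section DualBasics.
Variable E : Banach.
Implicit Types f g : dual E.
Implicit Types x y : E.

Lemma dapp_0 f : f bzero = 0.
Proof. rewrite <- (bscal_0 bzero), dapp_scal; ring. Qed.

Lemma dapp_opp f x : f (bopp x) = - f x.
Proof. rewrite bopp_scal, dapp_scal; ring. Qed.

Lemma dapp_minus f x y : f (bminus x y) = f x - f y.
Proof. unfold bminus; rewrite dapp_add, dapp_opp; ring. Qed.

Lemma dminus_app f g x : dminus f g x = f x - g x.
Proof. simpl; ring. Qed.

Lemma dual_ext f g : (forall x, f x = g x) -> f = g.
Proof.
  destruct f as [f fa fs fb], g as [g ga gs gb]; simpl; intro H.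
  assert (f = g) by (now apply functional_extensionality); subst g.
  f_equal; apply proof_irrelevance.
Qed.

Lemma dnorm_nonneg f : 0 <= dnorm f.
Proof. apply (dnorm_spec f). now intros y [Hy _]. Qed.

Lemma dnorm_le f M : 0 <= M -> (forall x, Rabs (f x) <= M * bnorm x) -> dnorm f <= M.
Proof. intros HM H. destruct (dnorm_spec f) as [H1 _]. apply H1. now split. Qed.

Lemma dnorm_eq0 f : dnorm f = 0 -> f = dzero E.
Proof.
  intro H. apply dual_ext; intro x; simpl.
  pose proof (dnorm_bound f x) as Hb. rewrite H, Rmult_0_l in Hb.
  pose proof (Rabs_pos (f x)).
  destruct (Req_dec (f x) 0) as [|Hn]; [easy|].
  apply Rabs_no_R0 in Hn; lra.
Qed.

Lemma dnorm_triangle f g : dnorm (dplus f g) <= dnorm f + dnorm g.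
Proof.
  apply dnorm_le; [pose proof (dnorm_nonneg f); pose proof (dnorm_nonneg g); lra|].
  intro x; simpl. pose proof (Rabs_triang (f x) (g x)).
  pose proof (dnorm_bound f x); pose proof (dnorm_bound g x); lra.
Qed.

Lemma dnorm_scale_le a f : dnorm (dscale a f) <= Rabs a * dnorm f.
Proof.
  apply dnorm_le; [apply Rmult_le_pos; [apply Rabs_pos | apply dnorm_nonneg]|].
  intro x; simpl. rewrite Rabs_mult, Rmult_assoc.
  apply Rmult_le_compat_l; [apply Rabs_pos | apply dnorm_bound].
Qed.

Lemma dnorm_scale a f : dnorm (dscale a f) = Rabs a * dnorm f.
Proof.
  apply Rle_antisym; [apply dnorm_scale_le|].
  destruct (Req_dec a 0) as [->|Ha].
  - rewrite Rabs_R0, Rmult_0_l; apply dnorm_nonneg.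
  - pose proof (dnorm_scale_le (/ a) (dscale a f)) as H.
    replace (dscale (/ a) (dscale a f)) with f in H
      by (apply dual_ext; intro; simpl; field; auto).
    assert (HA : 0 < Rabs a) by now apply Rabs_pos_lt.
    rewrite Rabs_inv in H.
    apply (Rmult_le_compat_l (Rabs a)) in H; [|lra].
    rewrite <- Rmult_assoc, Rinv_r, Rmult_1_l in H by lra. exact H.
Qed.

Lemma dual_complete (u : nat -> dual E) :
  (forall e, 0 < e -> exists N, forall n m, (N <= n)%nat -> (N <= m)%nat ->
     dnorm (dplus (u n) (dscale (-1) (u m))) < e) ->
  exists l, forall e, 0 < e -> exists N, forall n, (N <= n)%nat ->
     dnorm (dplus (u n) (dscale (-1) l)) < e.
Proof.
  intro HC.
  assert (Hx : forall x n m, Rabs (u n x - u m x) <= dnorm (dplus (u n) (dscale (-1) (u m))) * bnorm x).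
  { intros x n m. replace (u n x - u m x) with (dplus (u n) (dscale (-1) (u m)) x) by (simpl; ring).
    apply dnorm_bound. }
  assert (Hc : forall x, exists l, Un_cv (fun n => u n x) l).
  { intro x. destruct (R_complete (fun n => u n x)) as [l Hl]; [|now exists l].
    intros e He.
    assert (He' : 0 < e / (bnorm x + 1)).
    { pose proof (bnorm_nonneg x). apply Rdiv_lt_0_compat; lra. }
    destruct (HC _ He') as [N HN]. exists N; intros n m Hn Hm.
    unfold Rdist. eapply Rle_lt_trans; [apply Hx|].
    specialize (HN n m Hn Hm). pose proof (bnorm_nonneg x).
    apply Rle_lt_trans with (e / (bnorm x + 1) * bnorm x).
    - apply Rmult_le_compat_r; lra.
    - replace e with (e / (bnorm x + 1) * (bnorm x + 1)) at 2 by (field; lra).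
      apply Rmult_lt_compat_l; lra. }
  apply choice in Hc. destruct Hc as [l Hl].
  assert (HLe : forall e, 0 < e -> exists N, forall n, (N <= n)%nat -> forall x,
            Rabs (u n x - l x) <= e * bnorm x).
  { intros e He. destruct (HC _ He) as [N HN]. exists N; intros n Hn x.
    apply le_epsilon; intros d Hd.
    destruct (Hl x d Hd) as [N' HN']. set (k := Nat.max N N').
    specialize (HN' k ltac:(unfold k; lia)). unfold Rdist in HN'.
    specialize (HN n k Hn ltac:(unfold k; lia)).
    specialize (Hx x n k).
    pose proof (Rabs_triang (u n x - u k x) (u k x - l x)).
    replace (u n x - u k x + (u k x - l x)) with (u n x - l x) in * by ring.
    pose proof (bnorm_nonneg x). nra. }
  assert (Hadd : forall x y, l (badd x y) = l x + l y).
  { intros x y. apply (UL_sequence (fun n => u n (badd x y))); [apply Hl|].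
    intros e He. destruct (CV_plus _ _ _ _ (Hl x) (Hl y) e He) as [N HN].
    exists N; intros n Hn. rewrite dapp_add. now apply HN. }
  assert (Hscal : forall a x, l (bscal a x) = a * l x).
  { intros a x. apply (UL_sequence (fun n => u n (bscal a x))); [apply Hl|].
    intros e He.
    destruct (CV_mult (fun _ => a) (fun n => u n x) a (l x)) with (eps := e) as [N HN]; auto.
    - intros d Hd; exists O; intros; unfold Rdist; rewrite Rminus_diag, Rabs_R0; lra.
    - exists N; intros n Hn. rewrite dapp_scal. now apply HN. }
  assert (Hbnd : exists M, forall x, Rabs (l x) <= M * bnorm x).
  { destruct (HLe 1 Rlt_0_1) as [N HN]. exists (dnorm (u N) + 1); intro x.
    specialize (HN N (le_n _) x). pose proof (dnorm_bound (u N) x).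
    pose proof (Rabs_triang (l x - u N x) (u N x)).
    rewrite Rabs_minus_sym in HN.
    replace (l x - u N x + u N x) with (l x) in * by ring. lra. }
  exists (@mkDual E l Hadd Hscal Hbnd).
  intros e He. destruct (HLe (e / 2)) as [N HN]; [lra|].
  exists N; intros n Hn. apply Rle_lt_trans with (e / 2); [|lra].
  apply dnorm_le; [lra|]. intro x; simpl.
  replace (u n x + -1 * l x) with (u n x - l x) by ring. now apply HN.
Qed.

(** Transparent and with opposite [dscale (-1)], so that [bminus] in [dualB] is convertible to
    [dminus] and norm lemmas transfer by [exact]. *)
Definition dualB : Banach.
Proof.
  refine (@mkBanach (dual E) (dzero E) (@dplus E) (dscale (-1)) (@dscale E) (@dnorm E)
    _ _ _ _ _ _ _ _ dnorm_nonneg dnorm_eq0 dnorm_scale dnorm_triangle dual_complete);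
  intros; apply dual_ext; intro; simpl; ring.
Defined.

End DualBasics.

Section Product.
Variables E F : Banach.

Definition prodB : Banach.
Proof.
  refine (@mkBanach (E * F) (bzero, bzero)
    (fun p q => (badd (fst p) (fst q), badd (snd p) (snd q)))
    (fun p => (bopp (fst p), bopp (snd p)))
    (fun a p => (bscal a (fst p), bscal a (snd p)))
    (fun p => bnorm (fst p) + bnorm (snd p)) _ _ _ _ _ _ _ _ _ _ _ _ _).
  - intros [x y] [z w] [u v]; simpl; f_equal; apply badd_assoc.
  - intros [x y] [z w]; simpl; f_equal; apply badd_comm.
  - intros [x y]; simpl; f_equal; apply badd_0.
  - intros [x y]; simpl; f_equal; apply badd_opp.
  - intros a b [x y]; simpl; f_equal; apply bscal_assoc.
  - intros [x y]; simpl; f_equal; apply bscal_1.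
  - intros a [x y] [z w]; simpl; f_equal; apply bscal_distr_l.
  - intros a b [x y]; simpl; f_equal; apply bscal_distr_r.
  - intros [x y]; simpl. apply Rplus_le_le_0_compat; apply bnorm_nonneg.
  - intros [x y]; simpl; intro H.
    pose proof (bnorm_nonneg x); pose proof (bnorm_nonneg y).
    f_equal; apply bnorm_eq0; lra.
  - intros a [x y]; simpl. rewrite !bnorm_scal; ring.
  - intros [x y] [z w]; simpl.
    pose proof (bnorm_triangle x z); pose proof (bnorm_triangle y w); lra.
  - intros u Hu; simpl in *.
    destruct (bcomplete (u := fun n => fst (u n))) as [l Hl].
    { intros e He; destruct (Hu e He) as [N HN]; exists N; intros n m Hn Hm.
      specialize (HN n m Hn Hm).
      pose proof (bnorm_nonneg (badd (snd (u n)) (bopp (snd (u m))))); lra. }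
    destruct (bcomplete (u := fun n => snd (u n))) as [k Hk].
    { intros e He; destruct (Hu e He) as [N HN]; exists N; intros n m Hn Hm.
      specialize (HN n m Hn Hm).
      pose proof (bnorm_nonneg (badd (fst (u n)) (bopp (fst (u m))))); lra. }
    exists (l, k); intros e He; simpl.
    destruct (Hl (e / 2)) as [N HN]; [lra|]. destruct (Hk (e / 2)) as [N' HN']; [lra|].
    exists (Nat.max N N'); intros n Hn.
    specialize (HN n ltac:(lia)); specialize (HN' n ltac:(lia)); lra.
Defined.

End Product.

Definition RB : Banach.
Proof.
  refine (@mkBanach R 0 Rplus Ropp Rmult Rabs _ _ _ _ _ _ _ _ Rabs_pos _ Rabs_mult Rabs_triang _).
  all: try (intros; ring).
  - intros x H. destruct (Req_dec x 0) as [|Hn]; [easy|]. now apply Rabs_no_R0 in Hn.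
  - intros u Hu. destruct (R_complete u) as [l Hl].
    + intros e He; destruct (Hu e He) as [N HN]; exists N; intros n m Hn Hm. now apply HN.
    + exists l; intros e He; destruct (Hl e He) as [N HN]; exists N; intros n Hn. now apply HN.
Defined.

(** * The Hahn-Banach theorem *)

Definition Rinf (A : R -> Prop) : R := epsilon (inhabits 0) (is_inf A).

Lemma Rinf_spec (A : R -> Prop) (m y : R) :
  (forall z, A z -> m <= z) -> A y -> is_inf A (Rinf A).
Proof.
  intros Hm Hy. unfold Rinf; apply epsilon_spec.
  destruct (completeness (fun z => A (- z))) as [l [Hub Hl]].
  - exists (- m); intros z Hz. specialize (Hm _ Hz); lra.
  - exists (- y); now rewrite Ropp_involutive.
  - exists (- l); split.
    + intros z Hz. assert (- z <= l) by (apply Hub; now rewrite Ropp_involutive). lra.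
    + intros m' Hm'. assert (l <= - m') by (apply Hl; intros z Hz; specialize (Hm' _ Hz); lra).
      lra.
Qed.

Lemma is_inf_approx (A : R -> Prop) (m e : R) :
  is_inf A m -> 0 < e -> exists y, A y /\ y < m + e.
Proof.
  intros [_ H] He. apply NNPP; intro Hn.
  assert (m + e <= m); [|lra].
  apply H; intros y Hy. apply Rnot_lt_le; intro; apply Hn; now exists y.
Qed.

Section HahnBanach.
Variable E : Banach.
Implicit Types p q : E -> R.

Definition sublinear q :=
  (forall x y, q (badd x y) <= q x + q y) /\ (forall a x, 0 < a -> q (bscal a x) <= a * q x).

Lemma sublinear_scal q a x : sublinear q -> 0 < a -> q (bscal a x) = a * q x.
Proof.
  intros [_ H] Ha. apply Rle_antisym; [now apply H|].
  assert (Hi : 0 < / a) by now apply Rinv_0_lt_compat.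
  pose proof (H (/ a) (bscal a x) Hi) as H1.
  replace (bscal (/ a) (bscal a x)) with x in H1 by vec.
  apply (Rmult_le_compat_l a) in H1; [|lra].
  rewrite <- Rmult_assoc, Rinv_r, Rmult_1_l in H1 by lra. exact H1.
Qed.

Lemma sublinear_0 q : sublinear q -> q bzero = 0.
Proof.
  intro H. pose proof (sublinear_scal (a := 2) bzero H ltac:(lra)) as H1.
  rewrite bscal_bzero in H1. lra.
Qed.

Lemma sublinear_opp q x : sublinear q -> - q (bopp x) <= q x.
Proof.
  intro H. pose proof (proj1 H x (bopp x)) as H1.
  rewrite badd_opp, (sublinear_0 H) in H1. lra.
Qed.

(** Zorn's lemma. The infimum of a chain is subadditive because of two comparable members the
    smaller serves both arguments, and it is finite because every member is bounded below by
    [- p (bopp x)]. *)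
Lemma minimal_sublinear p :
  sublinear p ->
  exists q, sublinear q /\ (forall x, q x <= p x) /\
    forall q', sublinear q' -> (forall x, q' x <= q x) -> forall x, q x <= q' x.
Proof.
  intro Hp.
  pose (T := {q : E -> R | sublinear q /\ forall x, q x <= p x}).
  (* [ZL_preorder] takes a boolean relation. The order is reversed, so its maximal elements are
     minimal functionals. *)
  pose (r := fun a b : T =>
    if excluded_middle_informative (forall x, proj1_sig b x <= proj1_sig a x) then true else false).
  assert (Hr : forall a b, r a b = true <-> forall x, proj1_sig b x <= proj1_sig a x).
  { intros a b; unfold r; destruct excluded_middle_informative; split; easy. }
  assert (Hpp : forall x, p x <= p x) by (intro; lra).
  destruct (@classical_sets.ZL_preorder T (exist _ p (conj Hp Hpp)) r) as [a Hmax].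
  - intro a; apply Hr; intro; lra.
  - intros b a c Hab Hbc. apply Hr; intro x.
    apply Hr with (x := x) in Hab. apply Hr with (x := x) in Hbc. lra.
  - intros A Htot.
    destruct (classic (exists a, A a)) as [[a0 Ha0]|Hempty].
    2: { exists (exist _ p (conj Hp Hpp)). intros s Hs; exfalso; apply Hempty; now exists s. }
    pose (V := fun x z => exists a, A a /\ z = proj1_sig a x).
    pose (q := fun x => Rinf (V x)).
    assert (HV : forall x, is_inf (V x) (q x)).
    { intro x. apply (@Rinf_spec _ (- p (bopp x)) (proj1_sig a0 x)); [|now exists a0].
      intros z [a [_ ->]]. destruct a as [qa [Ha Hap]]; simpl.
      pose proof (sublinear_opp x Ha); specialize (Hap (bopp x)); lra. }
    assert (Hlb : forall a x, A a -> q x <= proj1_sig a x).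
    { intros a x Ha. apply (HV x). now exists a. }
    assert (Hq : sublinear q).
    { split.
      - intros x y. apply le_epsilon; intros e He.
        destruct (is_inf_approx (e := e / 2) (HV x)) as [z [[a [Ha ->]] Hz]]; [lra|].
        destruct (is_inf_approx (e := e / 2) (HV y)) as [w [[b [Hb ->]] Hw]]; [lra|].
        assert (Hc : exists c, A c /\ proj1_sig c x <= proj1_sig a x /\
                                 proj1_sig c y <= proj1_sig b y).
        { destruct (Htot a b Ha Hb) as [Hab|Hab]; pose proof (proj1 (Hr _ _) Hab) as Hab'.
          - exists b; repeat split; auto; lra.
          - exists a; repeat split; auto; lra. }
        destruct Hc as [c [Hc [H1 H2]]].
        specialize (Hlb c (badd x y) Hc).
        pose proof (proj1 (proj1 (proj2_sig c)) x y). lra.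
      - intros a x Ha. apply le_epsilon; intros e He.
        destruct (is_inf_approx (e := e / a) (HV x)) as [z [[b [Hb ->]] Hz]].
        { now apply Rdiv_lt_0_compat. }
        specialize (Hlb b (bscal a x) Hb).
        pose proof (proj2 (proj1 (proj2_sig b)) a x Ha).
        apply (Rmult_lt_compat_l a) in Hz; [|lra].
        replace (a * (q x + e / a)) with (a * q x + e) in Hz by (field; lra). lra. }
    assert (Hqp : forall x, q x <= p x).
    { intro x. pose proof (Hlb a0 x Ha0). pose proof (proj2 (proj2_sig a0) x). simpl in *; lra. }
    exists (exist _ q (conj Hq Hqp)). intros s Hs. apply Hr; intro x; simpl. now apply Hlb.
  - exists (proj1_sig a). destruct (proj2_sig a) as [Hq Hqp].
    split; [exact Hq | split; [exact Hqp|]].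
    intros q' Hq' Hle.
    assert (Hq'p : forall x, q' x <= p x) by (intro x; pose proof (Hle x); pose proof (Hqp x); lra).
    pose (b := exist _ q' (conj Hq' Hq'p) : T).
    exact (proj1 (Hr b a) (Hmax b (proj2 (Hr a b) Hle))).
Qed.

(** No extension from subspaces: a minimal sublinear functional below [p] is already additive, hence
    linear. *)
Lemma hahn_banach p :
  sublinear p ->
  exists l : E -> R, (forall x y, l (badd x y) = l x + l y) /\
    (forall a x, l (bscal a x) = a * l x) /\ (forall x, l x <= p x).
Proof.
  intro Hp. destruct (minimal_sublinear Hp) as [q [Hq [Hqp Hmin]]].
  assert (Hsup : forall x y, q x + q y <= q (badd x y)).
  { (* Minimality is applied to the sublinear function [inf_t q (x + t y) - t q y]. *)
    intros x0 y.
    pose (V := fun x z => exists t, 0 <= t /\ z = q (badd x (bscal t y)) - t * q y).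
    pose (q' := fun x => Rinf (V x)).
    assert (Hty : forall t, 0 <= t -> q (bscal t y) = t * q y).
    { intros t [Ht| <-]; [now apply sublinear_scal|].
      rewrite bscal_0, sublinear_0 by auto. ring. }
    assert (HV : forall x, is_inf (V x) (q' x)).
    { intro x. apply (@Rinf_spec _ (- q (bopp x)) (q (badd x (bscal 0 y)) - 0 * q y)).
      - intros z [t [Ht ->]].
        pose proof (proj1 Hq (badd x (bscal t y)) (bopp x)) as H.
        replace (badd (badd x (bscal t y)) (bopp x)) with (bscal t y) in H by vec.
        rewrite (Hty t Ht) in H. lra.
      - exists 0; split; [lra | easy]. }
    assert (Hlb : forall t x, 0 <= t -> q' x <= q (badd x (bscal t y)) - t * q y).
    { intros t x Ht. apply (HV x). now exists t. }
    assert (Hq' : sublinear q').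
    { split.
      - intros x z. apply le_epsilon; intros e He.
        destruct (is_inf_approx (e := e / 2) (HV x)) as [u [[t [Ht ->]] Hu]]; [lra|].
        destruct (is_inf_approx (e := e / 2) (HV z)) as [w [[s [Hs ->]] Hw]]; [lra|].
        specialize (Hlb (t + s) (badd x z) ltac:(lra)).
        pose proof (proj1 Hq (badd x (bscal t y)) (badd z (bscal s y))) as H.
        replace (badd (badd x (bscal t y)) (badd z (bscal s y)))
          with (badd (badd x z) (bscal (t + s) y)) in H by vec.
        lra.
      - intros a x Ha. apply le_epsilon; intros e He.
        destruct (is_inf_approx (e := e / a) (HV x)) as [z [[t [Ht ->]] Hz]].
        { now apply Rdiv_lt_0_compat. }
        specialize (Hlb (a * t) (bscal a x) ltac:(nra)).
        replace (badd (bscal a x) (bscal (a * t) y)) with (bscal a (badd x (bscal t y))) in Hlb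
          by vec.
        rewrite (sublinear_scal _ Hq Ha) in Hlb.
        apply (Rmult_lt_compat_l a) in Hz; [|lra].
        replace (a * (q' x + e / a)) with (a * q' x + e) in Hz by (field; lra). lra. }
    assert (Hle : forall x, q' x <= q x).
    { intro x. specialize (Hlb 0 x ltac:(lra)).
      replace (badd x (bscal 0 y)) with x in Hlb by vec. lra. }
    pose proof (Hmin q' Hq' Hle x0) as H1.
    specialize (Hlb 1 x0 ltac:(lra)). rewrite bscal_1 in Hlb. lra. }
  assert (Hadd : forall x y, q (badd x y) = q x + q y).
  { intros x y; apply Rle_antisym; [apply Hq | apply Hsup]. }
  assert (Hopp : forall x, q (bopp x) = - q x).
  { intro x. pose proof (Hadd x (bopp x)) as H. rewrite badd_opp, sublinear_0 in H by auto. lra. }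
  exists q; repeat split; auto.
  intros a x. destruct (Rtotal_order a 0) as [Ha|[->|Ha]].
  - replace (bscal a x) with (bopp (bscal (- a) x)) by vec.
    rewrite Hopp, sublinear_scal by (auto; lra). ring.
  - rewrite bscal_0, sublinear_0 by auto; ring.
  - now apply sublinear_scal.
Qed.

End HahnBanach.

(** * Separation of a convex relation from a convex function *)

Section Sandwich.
Variable E : Banach.

Definition convex_epi (C : E -> R -> Prop) :=
  forall x y r q t, C x r -> C y q -> 0 <= t <= 1 ->
    C (badd (bscal t x) (bscal (1 - t) y)) (t * r + (1 - t) * q).

Definition convex_fun (g : E -> R) :=
  forall x y t, 0 <= t <= 1 ->
    g (badd (bscal t x) (bscal (1 - t) y)) <= t * g x + (1 - t) * g y.

(* [l] is a subgradient at [0] of the value function [v |-> inf (r + g (x + v))];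
   it is bounded above by the sublinear infimum of its difference quotients. *)
Lemma sandwich (C : E -> R -> Prop) (g : E -> R) (x0 : E) (r0 N : R) :
  convex_epi C -> convex_fun g ->
  C x0 r0 -> (forall y, bnorm (bminus y x0) <= 1 -> g y <= N) ->
  (forall x r, C x r -> 0 <= r + g x) ->
  exists l : dual E, forall x r y, C x r -> l y - l x <= r + g y.
Proof.
  intros HC Hg H0 HN Hpos.
  pose (V := fun v z => exists t x r, 0 < t /\ C x r /\ z = (r + g (badd x (bscal t v))) / t).
  assert (Hcomb : forall v w x r t y q s, 0 < t -> 0 < s -> C x r -> C y q ->
    exists z k, C z k /\
      (k + g (badd z (bscal (t * s / (t + s)) (badd v w)))) / (t * s / (t + s))
        <= (r + g (badd x (bscal t v))) / t + (q + g (badd y (bscal s w))) / s).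
  { intros v w x r t y q s Ht Hs Hx Hy.
    assert (Hts : 0 < t * s) by nra.
    (* With this weight [c * t] and [(1 - c) * s] both equal [t * s / (t + s)], so the two steps
       merge into one along [badd v w]. *)
    pose (c := s / (t + s)).
    assert (Hc : 0 <= c <= 1).
    { unfold c; split; [apply Rlt_le, Rdiv_lt_0_compat; lra|].
      apply Rmult_le_reg_r with (t + s); [lra|]. unfold Rdiv; rewrite Rmult_assoc, Rinv_l; lra. }
    exists (badd (bscal c x) (bscal (1 - c) y)), (c * r + (1 - c) * q).
    split; [now apply HC|].
    pose proof (Hg (badd x (bscal t v)) (badd y (bscal s w)) c Hc) as H.
    replace (badd (bscal c (badd x (bscal t v))) (bscal (1 - c) (badd y (bscal s w))))
      with (badd (badd (bscal c x) (bscal (1 - c) y)) (bscal (t * s / (t + s)) (badd v w))) in H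
      by (unfold c; vec).
    apply Rmult_le_reg_r with (t * s / (t + s)); [apply Rdiv_lt_0_compat; lra|].
    replace (((r + g (badd x (bscal t v))) / t + (q + g (badd y (bscal s w))) / s) * (t * s / (t + s)))
      with (c * r + (1 - c) * q + (c * g (badd x (bscal t v)) + (1 - c) * g (badd y (bscal s w))))
      by (unfold c; field; lra).
    unfold Rdiv at 1. rewrite Rmult_assoc, Rinv_l, Rmult_1_r; [lra|].
    apply Rgt_not_eq, Rdiv_lt_0_compat; lra. }
  (* A quotient along [v] is combined with the unit step from [x0] along [bopp v]: the directions
     cancel, and the positivity hypothesis applies. *)
  assert (Hb0 : forall v z, V v z -> - (r0 + g (badd x0 (bscal 1 (bopp v)))) <= z).
  { intros v z [t [x [r [Ht [Hx ->]]]]].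
    destruct (Hcomb v (bopp v) x r t x0 r0 1 Ht Rlt_0_1 Hx H0) as [y [k [Hy Hk]]].
    rewrite badd_opp, bscal_bzero, badd_0 in Hk.
    assert (0 <= (k + g y) / (t * 1 / (t + 1))); [|lra].
    apply Rmult_le_pos; [auto|]. apply Rlt_le, Rinv_0_lt_compat, Rdiv_lt_0_compat; lra. }
  pose (p := fun v => Rinf (V v)).
  assert (HV : forall v, is_inf (V v) (p v)).
  { intro v. eapply Rinf_spec; [apply Hb0|]. exists 1, x0, r0. repeat split; auto; lra. }
  assert (Hlb : forall v t x r, 0 < t -> C x r -> p v <= (r + g (badd x (bscal t v))) / t).
  { intros v t x r Ht Hx. apply (HV v). now exists t, x, r. }
  assert (Hp : sublinear p).
  { split.
    - intros v w. apply le_epsilon; intros e He.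
      destruct (is_inf_approx (e := e / 2) (HV v)) as [u [[t [x [r [Ht [Hx ->]]]]] Hu]]; [lra|].
      destruct (is_inf_approx (e := e / 2) (HV w)) as [u [[s [y [q [Hs [Hy ->]]]]] Hu']]; [lra|].
      destruct (Hcomb v w x r t y q s Ht Hs Hx Hy) as [z [k [Hz Hk]]].
      assert (Hts : 0 < t * s / (t + s)) by (apply Rdiv_lt_0_compat; nra).
      specialize (Hlb (badd v w) _ z k Hts Hz). lra.
    - intros a v Ha. apply le_epsilon; intros e He.
      destruct (is_inf_approx (e := e / a) (HV v)) as [u [[t [x [r [Ht [Hx ->]]]]] Hu]].
      { now apply Rdiv_lt_0_compat. }
      specialize (Hlb (bscal a v) (t / a) x r ltac:(apply Rdiv_lt_0_compat; lra) Hx).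
      replace (bscal (t / a) (bscal a v)) with (bscal t v) in Hlb by vec.
      apply (Rmult_lt_compat_l a) in Hu; [|lra].
      replace (a * (p v + e / a)) with (a * p v + e) in Hu by (field; lra).
      replace ((r + g (badd x (bscal t v))) / (t / a))
        with (a * ((r + g (badd x (bscal t v))) / t)) in Hlb by (field; lra).
      lra. }
  destruct (hahn_banach Hp) as [l [Hadd [Hscal Hle]]].
  pose (M := Rabs (r0 + N)).
  assert (Hball : forall v, bnorm v <= 1 -> l v <= M).
  { intros v Hv. specialize (Hle v). specialize (Hlb v 1 x0 r0 Rlt_0_1 H0).
    specialize (HN (badd x0 (bscal 1 v))).
    replace (bminus (badd x0 (bscal 1 v)) x0) with v in HN by vec.
    specialize (HN Hv). pose proof (Rle_abs (r0 + N)). fold M in H. lra. }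
  assert (Hub : forall v, l v <= M * bnorm v).
  { intro v. destruct (Req_dec (bnorm v) 0) as [Hv|Hv].
    - apply bnorm_eq0 in Hv; subst v. rewrite bnorm_0, <- (bscal_0 bzero), Hscal. lra.
    - assert (Hv' : 0 < bnorm v) by (pose proof (bnorm_nonneg v); lra).
      specialize (Hball (bscal (/ bnorm v) v)).
      rewrite bnorm_scal_pos, Rinv_l in Hball by (auto; apply Rlt_le, Rinv_0_lt_compat; auto).
      specialize (Hball (Rle_refl _)). rewrite Hscal in Hball.
      apply (Rmult_le_compat_r (bnorm v)) in Hball; [|lra].
      replace (/ bnorm v * l v * bnorm v) with (l v) in Hball by (field; lra). exact Hball. }
  assert (Hbnd : exists M, forall x, Rabs (l x) <= M * bnorm x).
  { exists M; intro v. apply Rabs_le; split; [|apply Hub].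
    pose proof (Hub (bopp v)) as H. rewrite bnorm_opp, bopp_scal, Hscal in H. lra. }
  exists (@mkDual E l Hadd Hscal Hbnd); simpl. intros x r y Hx.
  specialize (Hle (bminus y x)). specialize (Hlb (bminus y x) 1 x r Rlt_0_1 Hx).
  replace (badd x (bscal 1 (bminus y x))) with y in Hlb by vec.
  unfold bminus in Hle at 1. rewrite Hadd, bopp_scal, Hscal in Hle. lra.
Qed.

End Sandwich.

(** * Epigraphs of strong representative functions *)

Lemma dependent_choice (A : Type) (P : nat -> A -> Prop) (Q : nat -> A -> A -> Prop) (a0 : A) :
  P O a0 -> (forall n a, P n a -> exists b, P (S n) b /\ Q n a b) ->
  exists u : nat -> A, u O = a0 /\ forall n, P n (u n) /\ Q n (u n) (u (S n)).
Proof.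
  intros H0 Hstep.
  assert (Hc : forall na : nat * A, exists b, P (fst na) (snd na) ->
             P (S (fst na)) b /\ Q (fst na) (snd na) b).
  { intros [n a]; simpl. destruct (classic (P n a)) as [H|H].
    - destruct (Hstep n a H) as [b Hb]; now exists b.
    - now exists a. }
  apply choice in Hc. destruct Hc as [next Hnext].
  pose (u := fix u n := match n with O => a0 | S n => next (n, u n) end).
  assert (HP : forall n, P n (u n)).
  { induction n as [|n IH]; [exact H0|]. exact (proj1 (Hnext (n, u n) IH)). }
  exists u; split; [easy|]. intro n; split; [apply HP|]. exact (proj2 (Hnext (n, u n) (HP n))).
Qed.

Lemma le_of_le_linear a b c : (forall t, 0 < t <= 1 -> a <= b + t * c) -> a <= b.
Proof.
  intro H. apply le_epsilon; intros e He.
  pose (t := e / (Rabs c + e)). pose proof (Rabs_pos c).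
  assert (Ht : 0 < t) by (apply Rdiv_lt_0_compat; lra).
  assert (Hte : t * (Rabs c + e) = e) by (unfold t; field; lra).
  assert (t <= 1) by nra.
  specialize (H t ltac:(lra)). pose proof (Rle_abs c). nra.
Qed.

Section Pair.
Variable X : Banach.
Implicit Types x y z : X.
Implicit Types xs ys zs : dual X.

Lemma bidual_ext (F G : bidual X) : (forall f, F f = G f) -> F = G.
Proof.
  destruct F as [f fa fs fb], G as [g ga gs gb]; simpl; intro H.
  assert (f = g) by (now apply functional_extensionality); subst g.
  f_equal; apply proof_irrelevance.
Qed.

Lemma bdapp_minus (F : bidual X) f g : F (dminus f g) = F f - F g.
Proof. unfold dminus; rewrite bdapp_add, bdapp_scal; ring. Qed.

Lemma bdapp_bound (F : bidual X) : exists K, 0 <= K /\ forall f, Rabs (F f) <= K * dnorm f.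
Proof.
  destruct (bdapp_bnd F) as [K HK]. exists (Rabs K); split; [apply Rabs_pos|].
  intro f. eapply Rle_trans; [apply HK|].
  apply Rmult_le_compat_r; [apply dnorm_nonneg | apply Rle_abs].
Qed.

(** [bidual] is a record of its own; this imports functionals that Hahn-Banach produces on
    [dualB X]. *)
Definition bidual_of (l : dual (dualB X)) : bidual X :=
  @mkBidual X (fun f => l f) (dapp_add l) (dapp_scal l) (dapp_bnd l).

Lemma dnorm_minus_triangle ys xs zs :
  dnorm (dminus xs zs) <= dnorm (dminus xs ys) + dnorm (dminus ys zs).
Proof. exact (bnorm_minus_triangle (E := dualB X) ys xs zs). Qed.

Lemma dnorm_minusC xs ys : dnorm (dminus xs ys) = dnorm (dminus ys xs).
Proof. exact (bnorm_minusC (E := dualB X) xs ys). Qed.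

Lemma dnorm_le_minus xs ys : dnorm xs <= dnorm ys + dnorm (dminus xs ys).
Proof. exact (bnorm_le_minus (E := dualB X) xs ys). Qed.

Lemma dapp_le_norms xs x M N :
  dnorm xs <= M -> bnorm x <= N -> Rabs (xs x) <= M * N.
Proof.
  intros HM HN. eapply Rle_trans; [apply dnorm_bound|].
  apply Rmult_le_compat; auto; [apply dnorm_nonneg | apply bnorm_nonneg].
Qed.

Definition pair_convex (C : X -> dual X -> R -> Prop) :=
  forall x xs r y ys q t, C x xs r -> C y ys q -> 0 <= t <= 1 ->
    C (badd (bscal t x) (bscal (1 - t) y)) (dplus (dscale t xs) (dscale (1 - t) ys))
      (t * r + (1 - t) * q).

Definition pair_convex_fun (g : X -> dual X -> R) :=
  forall x xs y ys t, 0 <= t <= 1 ->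
    g (badd (bscal t x) (bscal (1 - t) y)) (dplus (dscale t xs) (dscale (1 - t) ys))
      <= t * g x xs + (1 - t) * g y ys.

(** Fenchel duality: the supremum of the left side over [C] is the conjugate of [C] at [(ws, wss)],
    and the infimum of the right side is minus the conjugate of [g] at the opposite point. The
    functional given by [sandwich] is restricted to the two axes, after a change of sign. *)
Lemma sandwich_pair (C : X -> dual X -> R -> Prop) (g : X -> dual X -> R) x0 xs0 r0 N :
  pair_convex C -> pair_convex_fun g -> C x0 xs0 r0 ->
  (forall y ys, bnorm (bminus y x0) <= 1 -> dnorm (dminus ys xs0) <= 1 -> g y ys <= N) ->
  (forall x xs r, C x xs r -> 0 <= r + g x xs) ->
  exists (ws : dual X) (wss : bidual X), forall x xs r y ys, C x xs r ->
    ws x + wss xs - r <= g y ys + ws y + wss ys.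
Proof.
  intros HC Hg H0 HN Hpos.
  pose (E := prodB X (dualB X)).
  destruct (@sandwich E (fun p r => C (fst p) (snd p) r) (fun p => g (fst p) (snd p)) (x0, xs0) r0 N)
    as [l Hl].
  - intros [x xs] [y ys] r q t; simpl. apply HC.
  - intros [x xs] [y ys] t; simpl. apply Hg.
  - exact H0.
  - intros [y ys]; simpl. intro H.
    pose proof (bnorm_nonneg (badd y (bopp x0))).
    pose proof (dnorm_nonneg (dplus ys (dscale (-1) xs0))).
    apply HN; unfold bminus, dminus; lra.
  - intros [x xs] r; simpl. apply Hpos.
  - pose (l' := dscale (-1) l).
    assert (Hb : exists M, 0 <= M /\ forall x xs, Rabs (l' ((x, xs) : E)) <= M * (bnorm x + dnorm xs)).
    { exists (dnorm l'); split; [apply dnorm_nonneg|]. intros x xs. exact (dnorm_bound l' ((x, xs) : E)). }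
    destruct Hb as [M [HM Hb]].
    assert (Hz : dnorm (dzero X) = 0) by exact (bnorm_0 (dualB X)).
    assert (Hws : exists ws : dual X, forall x, ws x = l' ((x, dzero X) : E)).
    { unshelve eexists (@mkDual X (fun x => l' ((x, dzero X) : E)) _ _ _); [| | |easy].
      - intros x y; cbv beta. rewrite <- dapp_add. simpl. repeat f_equal. apply dual_ext; intro; simpl; ring.
      - intros a x; cbv beta. rewrite <- dapp_scal. simpl. repeat f_equal. apply dual_ext; intro; simpl; ring.
      - exists M; intro x. specialize (Hb x (dzero X)). now rewrite Hz, Rplus_0_r in Hb. }
    assert (Hwss : exists wss : bidual X, forall xs, wss xs = l' ((bzero, xs) : E)).
    { unshelve eexists (@mkBidual X (fun xs => l' ((bzero, xs) : E)) _ _ _); [| | |easy].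
      - intros x y; cbv beta. rewrite <- dapp_add. simpl. repeat f_equal. vec.
      - intros a x; cbv beta. rewrite <- dapp_scal. simpl. repeat f_equal. vec.
      - exists M; intro xs. specialize (Hb bzero xs). now rewrite bnorm_0, Rplus_0_l in Hb. }
    destruct Hws as [ws Hws], Hwss as [wss Hwss].
    assert (Hs : forall x xs, l' ((x, xs) : E) = ws x + wss xs).
    { intros x xs. rewrite Hws, Hwss, <- dapp_add. apply (f_equal (dapp l')). simpl. f_equal; [vec|].
      apply dual_ext; intro; simpl; ring. }
    exists ws, wss; intros x xs r y ys Hx.
    specialize (Hl ((x, xs) : E) r ((y, ys) : E) Hx).
    pose proof (Hs x xs) as H1; pose proof (Hs y ys) as H2. simpl in Hl, H1, H2. lra.
Qed.

(** The epigraph of a closed convex function that dominates the coupling together with its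
    conjugate. A relation avoids extended values and lets an inf-convolution be closed as a set,
    without choosing infima. *)
Record strong_epi (C : X -> dual X -> R -> Prop) : Prop := {
  epi_convex : pair_convex C;
  epi_closed : forall x xs r,
    (forall e, 0 < e -> exists y ys q, C y ys q /\ bnorm (bminus y x) < e /\
        dnorm (dminus ys xs) < e /\ Rabs (q - r) < e) -> C x xs r;
  epi_ge : forall x xs r, C x xs r -> xs x <= r;
  epi_conj : forall xs (xss : bidual X) b, b < xss xs ->
    exists x ys r, C x ys r /\ b < xs x + xss ys - r
}.

Definition contact (C : X -> dual X -> R -> Prop) : multifun X := fun x xs => C x xs (xs x).

Lemma convex_sqr a b t : 0 <= t <= 1 ->
  (t * a + (1 - t) * b) * (t * a + (1 - t) * b) <= t * (a * a) + (1 - t) * (b * b).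
Proof.
  intro Ht. assert (0 <= t * (1 - t) * (a - b) ^ 2); [|nra].
  apply Rmult_le_pos; [apply Rmult_le_pos; lra | apply pow2_ge_0].
Qed.

Lemma convex_norm_minus (E : Banach) (x y z : E) t : 0 <= t <= 1 ->
  bnorm (bminus (badd (bscal t x) (bscal (1 - t) y)) z)
    <= t * bnorm (bminus x z) + (1 - t) * bnorm (bminus y z).
Proof.
  intro H.
  replace (bminus (badd (bscal t x) (bscal (1 - t) y)) z)
    with (badd (bscal t (bminus x z)) (bscal (1 - t) (bminus y z))) by vec.
  now apply bnorm_comb.
Qed.

Lemma convex_norm_minus_sqr (E : Banach) (x y z : E) t : 0 <= t <= 1 ->
  bnorm (bminus (badd (bscal t x) (bscal (1 - t) y)) z) ^ 2
    <= t * bnorm (bminus x z) ^ 2 + (1 - t) * bnorm (bminus y z) ^ 2.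
Proof.
  intro H. pose proof (convex_norm_minus x y z H) as H1.
  pose proof (convex_sqr (bnorm (bminus x z)) (bnorm (bminus y z)) H) as H2.
  pose proof (bnorm_nonneg (bminus (badd (bscal t x) (bscal (1 - t) y)) z)).
  nra.
Qed.

(** The conjugate of [s / 2 * bnorm p ^ 2] is [dnorm f ^ 2 / (2 * s)]. *)
Lemma dnorm_sqr_le_of_quadratic (f : dual X) s k :
  0 < s -> (forall p, f p <= s / 2 * bnorm p ^ 2 + k) -> dnorm f ^ 2 <= 2 * s * k.
Proof.
  intros Hs H.
  assert (Hk : 0 <= k).
  { specialize (H bzero). rewrite dapp_0, bnorm_0 in H. lra. }
  assert (Hsk : 0 <= 2 * s * k) by (apply Rmult_le_pos; lra).
  assert (Hf : dnorm f <= sqrt (2 * s * k)).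
  { apply dnorm_le; [apply sqrt_pos|]. intro p.
    destruct (Req_dec (bnorm p) 0) as [H0|H0].
    - apply bnorm_eq0 in H0; subst p. rewrite dapp_0, bnorm_0, Rabs_R0; lra.
    - assert (Hn : 0 < bnorm p) by (pose proof (bnorm_nonneg p); lra).
      set (n := bnorm p) in *. set (v := f p).
      assert (Hv : v ^ 2 <= 2 * s * k * n ^ 2).
      (* This factor maximizes [t * v - s / 2 * t ^ 2 * n ^ 2] over [t]. *)
      { pose proof (H (bscal (v / (s * n ^ 2)) p)) as H1.
        rewrite dapp_scal, bnorm_scal in H1. fold n v in H1.
        rewrite Rpow_mult_distr, pow2_abs in H1.
        assert (0 < s * n ^ 2) by (apply Rmult_lt_0_compat; [lra | apply pow_lt; lra]).
        apply (Rmult_le_compat_l (2 * (s * n ^ 2))) in H1; [|lra].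
        replace (2 * (s * n ^ 2) * (v / (s * n ^ 2) * v)) with (2 * v ^ 2) in H1 by (field; lra).
        replace (2 * (s * n ^ 2) * (s / 2 * ((v / (s * n ^ 2)) ^ 2 * n ^ 2) + k))
          with (v ^ 2 + 2 * s * k * n ^ 2) in H1 by (field; lra).
        lra. }
      replace (Rabs v) with (sqrt (v ^ 2)) by (rewrite <- pow2_abs; apply sqrt_pow2, Rabs_pos).
      replace (sqrt (2 * s * k) * n) with (sqrt (2 * s * k * n ^ 2)).
      + now apply sqrt_le_1_alt.
      + rewrite sqrt_mult by (auto; apply pow_le; lra). now rewrite sqrt_pow2 by lra. }
  pose proof (dnorm_nonneg f). pose proof (sqrt_sqrt _ Hsk). pose proof (sqrt_pos (2 * s * k)). nra.
Qed.

(* The regularized infimum is nonpositive: otherwise [sandwich_pair] produces [ws, wss]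
   violating [epi_conj], as is seen by testing at [y = z - p], [ys = ws]. *)
Lemma strong_epi_approx C z zs s e :
  strong_epi C -> 0 < s -> 0 < e ->
  exists x xs r, C x xs r /\ r <= xs x + e /\
    r - xs z - zs x + zs z + s / 2 * bnorm (bminus x z) ^ 2
      + / (2 * s) * dnorm (dminus xs zs) ^ 2 < e.
Proof.
  intros HC Hs He.
  assert (Hsi : 0 < / (2 * s)) by (apply Rinv_0_lt_compat; lra).
  (* The bound on [r] is implied: the expression equals [r - xs x] plus the pairing of [xs - zs]
     with [x - z] plus two squares, and by Young's inequality the squares outweigh the pairing. *)
  cut (exists x xs r, C x xs r /\
    r - xs z - zs x + zs z + s / 2 * bnorm (bminus x z) ^ 2
      + / (2 * s) * dnorm (dminus xs zs) ^ 2 < e).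
  { intros [x [xs [r [Hx Hr]]]]. exists x, xs, r; repeat split; auto.
    pose proof (dnorm_bound (dminus xs zs) (bminus x z)) as H.
    rewrite dminus_app, !dapp_minus in H.
    pose proof (Rle_abs (- (xs x - xs z - (zs x - zs z)))) as H1. rewrite Rabs_Ropp in H1.
    set (m := bnorm (bminus x z)) in *. set (n := dnorm (dminus xs zs)) in *.
    assert (n * m <= s / 2 * m ^ 2 + / (2 * s) * n ^ 2); [|lra].
    assert (0 <= / (2 * s) * (s * m - n) ^ 2) by (apply Rmult_le_pos; [lra | apply pow2_ge_0]).
    replace (/ (2 * s) * (s * m - n) ^ 2) with (s / 2 * m ^ 2 + / (2 * s) * n ^ 2 - n * m) in H0
      by (field; lra). lra. }
  apply NNPP; intro Hn.
  pose (g := fun y ys => - ys z - zs y + zs z + s / 2 * bnorm (bminus y z) ^ 2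
      + / (2 * s) * dnorm (dminus ys zs) ^ 2 - e).
  destruct (epi_conj HC (xs := dzero X) (xss := J bzero) (b := -1)) as [x0 [xs0 [r0 [H0 _]]]].
  { simpl; lra. }
  destruct (@sandwich_pair C g x0 xs0 r0
     ((dnorm xs0 + 1) * bnorm z + dnorm zs * (bnorm x0 + 1) + zs z
       + s / 2 * (bnorm (bminus x0 z) + 1) ^ 2 + / (2 * s) * (dnorm (dminus xs0 zs) + 1) ^ 2))
    as [ws [wss Hw]]; auto.
  - apply HC.
  - intros x xs y ys t Ht. unfold g.
    pose proof (convex_norm_minus_sqr x y z Ht) as H1.
    pose proof (convex_norm_minus_sqr (xs : dualB X) (ys : dualB X) (zs : dualB X) Ht) as H2.
    change (dnorm (dminus (dplus (dscale t xs) (dscale (1 - t) ys)) zs) ^ 2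
       <= t * dnorm (dminus xs zs) ^ 2 + (1 - t) * dnorm (dminus ys zs) ^ 2) in H2.
    apply (Rmult_le_compat_l (s / 2)) in H1; [|lra].
    apply (Rmult_le_compat_l (/ (2 * s))) in H2; [|lra].
    rewrite dapp_add, !dapp_scal. simpl (dplus _ _ _) in *. lra.
  - intros y ys Hy Hys. unfold g.
    assert (A1 : Rabs (ys z) <= (dnorm xs0 + 1) * bnorm z).
    { apply dapp_le_norms; [|lra]. pose proof (dnorm_le_minus ys xs0); lra. }
    assert (A2 : Rabs (zs y) <= dnorm zs * (bnorm x0 + 1)).
    { apply dapp_le_norms; [lra|]. pose proof (bnorm_le_minus y x0); lra. }
    pose proof (bnorm_minus_triangle x0 y z) as B1.
    pose proof (dnorm_minus_triangle xs0 ys zs) as B2.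
    assert (B1' : bnorm (bminus y z) ^ 2 <= (bnorm (bminus x0 z) + 1) ^ 2).
    { apply pow_incr; split; [apply bnorm_nonneg | lra]. }
    assert (B2' : dnorm (dminus ys zs) ^ 2 <= (dnorm (dminus xs0 zs) + 1) ^ 2).
    { apply pow_incr; split; [apply dnorm_nonneg | lra]. }
    apply (Rmult_le_compat_l (s / 2)) in B1'; [|lra].
    apply (Rmult_le_compat_l (/ (2 * s))) in B2'; [|lra].
    pose proof (Rle_abs (- ys z)); pose proof (Rle_abs (- zs y)). rewrite Rabs_Ropp in *. lra.
  - intros x xs r Hx. unfold g. apply Rnot_lt_le; intro Hlt. apply Hn.
    exists x, xs, r; split; [auto | lra].
  - assert (Hwle : forall y ys, wss ws <= g y ys + ws y + wss ys).
    { intros y ys. apply Rnot_lt_le; intro Hlt.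
      destruct (epi_conj HC Hlt) as [x [xs [r [Hx Hr]]]].
      specialize (Hw x xs r y ys Hx). lra. }
    pose proof (@dnorm_sqr_le_of_quadratic (dminus ws zs) s
      (/ (2 * s) * dnorm (dminus ws zs) ^ 2 - e) Hs) as Hq.
    assert (Hcontra : dnorm (dminus ws zs) ^ 2
        <= 2 * s * (/ (2 * s) * dnorm (dminus ws zs) ^ 2 - e)).
    { apply Hq; intro p. specialize (Hwle (bminus z p) ws). unfold g in Hwle.
      replace (bminus (bminus z p) z) with (bopp p) in Hwle by vec.
      rewrite bnorm_opp, !dapp_minus in Hwle. rewrite dminus_app. lra. }
    replace (2 * s * (/ (2 * s) * dnorm (dminus ws zs) ^ 2 - e))
      with (dnorm (dminus ws zs) ^ 2 - 2 * s * e) in Hcontra by (field; lra).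
    assert (0 < s * e) by (apply Rmult_lt_0_compat; lra). lra.
Qed.

(** * Contact sets: the Broendsted-Rockafellar property and maximality *)

Lemma strong_epi_closed_contact C z zs :
  strong_epi C ->
  (forall e, 0 < e -> exists y ys q, C y ys q /\ bnorm (bminus y z) < e /\
     dnorm (dminus ys zs) < e /\ Rabs (q - ys y) < e) ->
  contact C z zs.
Proof.
  intros HC H. apply (epi_closed HC). intros e He.
  (* Within distance [d <= 1] the coupling changes by at most [d * (1 + bnorm z + dnorm zs)], and
     the value is off by less than [d]. *)
  pose (K := 3 + bnorm z + dnorm zs).
  assert (HK : 3 <= K).
  { unfold K; pose proof (bnorm_nonneg z); pose proof (dnorm_nonneg zs); lra. }
  pose (d := Rmin 1 (e / K)).
  assert (Hd : 0 < d) by (apply Rmin_glb_lt; [lra | apply Rdiv_lt_0_compat; lra]).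
  assert (Hd1 : d <= 1) by apply Rmin_l.
  assert (Hde : d * K <= e).
  { assert (d <= e / K) by apply Rmin_r. apply (Rmult_le_compat_r K) in H0; [|lra].
    unfold Rdiv in H0. rewrite Rmult_assoc, Rinv_l in H0; lra. }
  destruct (H d Hd) as [y [ys [q [Hy [H1 [H2 H3]]]]]].
  exists y, ys, q. repeat split; auto; try nra.
  pose proof (bnorm_le_minus y z) as Hny.
  assert (A1 : Rabs (dminus ys zs y) <= d * (bnorm z + 1)) by (apply dapp_le_norms; lra).
  assert (A2 : Rabs (zs (bminus y z)) <= dnorm zs * d) by (apply dapp_le_norms; lra).
  rewrite dminus_app in A1. rewrite dapp_minus in A2.
  replace (q - zs z) with ((q - ys y) + ((ys y - zs y) + (zs y - zs z))) by ring.
  eapply Rle_lt_trans; [apply Rabs_triang|].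
  pose proof (Rabs_triang (ys y - zs y) (zs y - zs z)).
  unfold K in Hde. nra.
Qed.

(** [C] dominates the coupling at the midpoint. For contact points this is monotonicity; in general
    the gaps [r - xs x] and [q - ys y] limit how negative the pairing of the differences can be. *)
Lemma pair_midpoint C x xs r y ys q :
  strong_epi C -> C x xs r -> C y ys q -> (xs x + xs y + ys x + ys y) / 4 <= (r + q) / 2.
Proof.
  intros HC Hx Hy.
  pose proof (epi_ge HC (epi_convex HC Hx Hy (t := / 2) ltac:(lra))) as H.
  simpl in H. rewrite !dapp_add, !dapp_scal in H. lra.
Qed.

Lemma contact_monotone C : strong_epi C -> monotone (contact C).
Proof.
  intros HC x xs y ys Hx Hy. pose proof (pair_midpoint HC Hx Hy) as H.
  rewrite dminus_app, !dapp_minus. lra.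
Qed.

(** A move of at most three units [a] and [b] divides the bound on the gap by four, so the step can
    be repeated with both units halved. *)
Lemma broendsted_rockafellar_step C z zs r0 a b :
  strong_epi C -> 0 < a -> 0 < b -> C z zs r0 -> r0 <= zs z + a * b ->
  exists x xs r, C x xs r /\ r <= xs x + a / 2 * (b / 2) /\
    bnorm (bminus x z) <= 3 * a /\ dnorm (dminus xs zs) <= 3 * b.
Proof.
  intros HC Ha Hb Hz H0.
  assert (Hab : 0 < a * b) by nra.
  (* With the weight [b / a] both squares get the coefficient [a * b / 2] when distances are
     measured in the units [a] and [b]. *)
  destruct (@strong_epi_approx C z zs (b / a) (a / 2 * (b / 2)) HC) as [x [xs [r [Hx [Hr HQ]]]]].
  { apply Rdiv_lt_0_compat; lra. } { lra. }
  exists x, xs, r; split; [auto | split; [auto|]].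
  pose proof (pair_midpoint HC Hx Hz) as Hm.
  pose proof (dnorm_bound (dminus xs zs) (bminus x z)) as H.
  rewrite dminus_app, !dapp_minus in H.
  pose proof (Rle_abs (- (xs x - xs z - (zs x - zs z)))) as H1. rewrite Rabs_Ropp in H1.
  pose proof (bnorm_nonneg (bminus x z)) as Hm0. pose proof (dnorm_nonneg (dminus xs zs)) as Hn0.
  set (m := bnorm (bminus x z)) in *. set (n := dnorm (dminus xs zs)) in *.
  pose (u := m / a). pose (v := n / b).
  assert (Hu : m = u * a) by (unfold u; field; lra).
  assert (Hv : n = v * b) by (unfold v; field; lra).
  assert (Hu0 : 0 <= u) by (apply Rmult_le_pos; [auto | apply Rlt_le, Rinv_0_lt_compat; auto]).
  assert (Hv0 : 0 <= v) by (apply Rmult_le_pos; [auto | apply Rlt_le, Rinv_0_lt_compat; auto]).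
  rewrite Hu, Hv in *.
  replace (b / a / 2 * (u * a) ^ 2 + / (2 * (b / a)) * (v * b) ^ 2)
    with (a * b * ((u ^ 2 + v ^ 2) / 2)) in * by (field; lra).
  assert (HQ' : r - xs z - zs x + zs z + a * b * ((u ^ 2 + v ^ 2) / 2) < a / 2 * (b / 2)).
  { replace (a * b * ((u ^ 2 + v ^ 2) / 2))
      with (b / a / 2 * (u * a) ^ 2 + / (2 * (b / a)) * (v * b) ^ 2) by (field; lra). lra. }
  (* Young's inequality gives [r - xs x < a * b / 4]; then [pair_midpoint] bounds the pairing below
     by [- 5 / 2 * (a * b)]. Hence [u ^ 2 + v ^ 2 <= 5], and each distance is below three units. *)
  assert (Hfin : a * b * (u ^ 2 + v ^ 2) <= a * b * 5).
  { assert (v * b * (u * a) <= a * b * ((u ^ 2 + v ^ 2) / 2)).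
    { replace (v * b * (u * a)) with (a * b * (u * v)) by ring.
      apply Rmult_le_compat_l; [lra|]. pose proof (pow2_ge_0 (u - v)); nra. }
    lra. }
  apply Rmult_le_reg_l in Hfin; [|auto].
  split; apply Rmult_le_compat_r; nra.
Qed.

(** The moves [3 * a / 2 ^ n] sum to [6 * a], while the gap, at most [a * b / 4 ^ n], vanishes in
    the limit. Only the product [a * b] is constrained, so one displacement can be made small at the
    expense of the other. *)
Lemma broendsted_rockafellar C z zs r0 a b :
  strong_epi C -> 0 < a -> 0 < b -> C z zs r0 -> r0 <= zs z + a * b ->
  exists y ys, contact C y ys /\ bnorm (bminus y z) <= 6 * a /\ dnorm (dminus ys zs) <= 6 * b.
Proof.
  intros HC Ha Hb Hz H0.
  pose (h := fun n => (/ 2) ^ n).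
  assert (Hh : forall n, 0 < h n) by (intro; apply half_pow_pos).
  destruct (@dependent_choice (X * dual X * R)
    (fun n p => C (fst (fst p)) (snd (fst p)) (snd p) /\
       snd p <= snd (fst p) (fst (fst p)) + (a * h n) * (b * h n))
    (fun n p q => bnorm (bminus (fst (fst q)) (fst (fst p))) <= 3 * a * h n /\
       dnorm (dminus (snd (fst q)) (snd (fst p))) <= 3 * b * h n) (z, zs, r0)) as [u [Hu0 Hu]].
  - simpl. split; [auto|]. unfold h; simpl; lra.
  - intros n [[x xs] r]; simpl. intros [Hx Hr].
    destruct (@broendsted_rockafellar_step C x xs r (a * h n) (b * h n) HC) as [y [ys [q [Hy [Hq [H1 H2]]]]]]; auto.
    { apply Rmult_lt_0_compat; auto. } { apply Rmult_lt_0_compat; auto. }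
    exists (y, ys, q); simpl. unfold h in *; simpl. repeat split; auto; lra.
  - destruct (@geometric_cauchy X (fun n => fst (fst (u n))) (3 * a)) as [y Hy].
    { intro n; apply Hu. }
    destruct (@geometric_cauchy (dualB X) (fun n => snd (fst (u n))) (3 * b)) as [ys Hys].
    { intro n; apply Hu. }
    exists y, ys. split; [|split].
    + apply (strong_epi_closed_contact HC). intros e He.
      destruct (half_pow_small (2 * (3 * a)) He) as [N1 HN1].
      destruct (half_pow_small (2 * (3 * b)) He) as [N2 HN2].
      destruct (half_pow_small (a * b) He) as [N3 HN3].
      pose (n := Nat.max N1 (Nat.max N2 N3)).
      specialize (HN1 n ltac:(unfold n; lia)). specialize (HN2 n ltac:(unfold n; lia)).
      specialize (HN3 n ltac:(unfold n; lia)).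
      destruct (Hu n) as [[HCn Hrn] _].
      exists (fst (fst (u n))), (snd (fst (u n))), (snd (u n)). repeat split; auto.
      * eapply Rle_lt_trans; [apply Hy | auto].
      * eapply Rle_lt_trans; [apply (Hys n) | auto].
      * pose proof (epi_ge HC HCn). rewrite Rabs_pos_eq by lra.
        assert (h n <= 1) by (unfold h; rewrite <- (pow1 n); apply pow_incr; lra).
        assert (a * h n * (b * h n) <= a * b * h n).
        { replace (a * h n * (b * h n)) with (a * b * h n * h n) by ring.
          rewrite <- (Rmult_1_r (a * b * h n)) at 2.
          apply Rmult_le_compat_l; [|auto]. specialize (Hh n). assert (0 < a * b) by nra. nra. }
        unfold h in *; lra.
    + specialize (Hy O). rewrite Hu0 in Hy. rewrite bnorm_minusC. simpl in Hy; lra.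
    + specialize (Hys O). rewrite Hu0 in Hys. rewrite dnorm_minusC.
      change (dnorm (dminus zs ys) <= 2 * (3 * b) * (/ 2) ^ 0) in Hys. simpl in Hys; lra.
Qed.

(** The approximants of [(z, zs)] lie close to contact points, where the pairing with [(z, zs)] is
    nonnegative by hypothesis. Their own pairing is then nearly nonnegative, which forces both
    squares in [strong_epi_approx] to be small. *)
Lemma contact_of_monotone_related C z zs :
  strong_epi C ->
  (forall y ys, contact C y ys -> 0 <= dminus ys zs (bminus y z)) -> contact C z zs.
Proof.
  intros HC Hrel. apply (strong_epi_closed_contact HC). intros d Hd.
  pose (e := d / 26). assert (He : 0 < e) by (unfold e; lra).
  destruct (@strong_epi_approx C z zs 1 (e * e) HC) as [x [xs [r [Hx [Hr HQ]]]]]; [lra | nra |].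
  destruct (broendsted_rockafellar HC He He Hx Hr) as [y [ys [Hy [H1 H2]]]].
  specialize (Hrel y ys Hy). rewrite dminus_app, !dapp_minus in Hrel.
  pose proof (epi_ge HC Hx) as Hge.
  pose proof (bnorm_nonneg (bminus x z)) as Hm0. pose proof (dnorm_nonneg (dminus xs zs)) as Hn0.
  pose proof (bnorm_minus_triangle x y z) as T1.
  pose proof (dnorm_minus_triangle xs ys zs) as T2.
  set (m := bnorm (bminus x z)) in *. set (n := dnorm (dminus xs zs)) in *.
  assert (A1 : Rabs (dminus xs zs (bminus y x)) <= n * (6 * e))
    by (apply dapp_le_norms; unfold n; lra).
  assert (A2 : Rabs (dminus ys xs (bminus y z)) <= 6 * e * (6 * e + m)).
  { apply dapp_le_norms; lra. }
  rewrite dminus_app, !dapp_minus in A1, A2.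
  pose proof (Rle_abs (ys y - ys z - (xs y - xs z))).
  pose proof (Rle_abs (xs y - xs x - (zs y - zs x))).
  (* Completing squares turns the error [37 * e ^ 2] into [74 + 72 = 146]. This gives distances at
     most [19 * e], and [25 * e] after the move to [y], just below [d = 26 * e]. *)
  assert (Hq : (m - 6 * e) ^ 2 + (n - 6 * e) ^ 2 <= 146 * (e * e)).
  { replace (/ (2 * 1)) with (/ 2) in HQ by (f_equal; ring). nra. }
  assert (Hle : forall u v, 0 <= u -> (u - 6 * e) ^ 2 + (v - 6 * e) ^ 2 <= 146 * (e * e) ->
                  u <= 19 * e).
  { intros u v Hu Huv. apply Rnot_lt_le; intro Hlt.
    assert (0 < (u - 19 * e) * (u + 7 * e)) by (apply Rmult_lt_0_compat; lra).
    pose proof (pow2_ge_0 (v - 6 * e)). assert (0 < e * e) by nra. nra. }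
  assert (Hm : m <= 19 * e) by (apply Hle with n; auto).
  assert (Hn : n <= 19 * e) by (apply Hle with m; [auto | lra]).
  exists y, ys, (ys y). repeat split; auto; unfold e in *; try lra.
  rewrite Rminus_diag, Rabs_R0; lra.
Qed.

Lemma contact_maximal C : strong_epi C -> maximal_monotone (contact C).
Proof.
  intro HC. split; [now apply contact_monotone|].
  intros S' Hmon Hsub x xs Hx. apply contact_of_monotone_related; auto.
Qed.

(* The contact set is of "negative infimum" type. Approximating at [(0, zs)] with the
   weight [s] small makes the term [zss (xs - zs)] absorbable by [|xs - zs|^2 / 2s]. *)
Lemma contact_conj C zs (zss : bidual X) b :
  strong_epi C -> b < zss zs ->
  exists y ys, contact C y ys /\ b < zs y + zss ys - ys y.
Proof.
  intros HC Hb. destruct (bdapp_bound zss) as [K [HK Hzss]].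
  set (d := zss zs - b). assert (Hd : 0 < d) by (unfold d; lra).
  assert (HK2 : 1 <= (1 + K) ^ 2) by nra.
  (* The losses collected in [B1] to [B5] total at most [s * (2 + K + (1 + K) ^ 2 / 2)]; this [s]
     keeps them below the gap [d]. *)
  pose (s := d / (3 * (1 + K) ^ 2 + d)).
  assert (Hs : 0 < s) by (apply Rdiv_lt_0_compat; lra).
  assert (Hsd : s * (3 * (1 + K) ^ 2 + d) = d) by (unfold s; field; lra).
  assert (Hs1 : s <= 1) by nra.
  pose (e := s / 6). assert (He : 0 < e) by (unfold e; lra).
  destruct (@strong_epi_approx C bzero zs s (e * e) HC) as [x [xs [r [Hx [Hr HQ]]]]]; [lra | nra |].
  destruct (broendsted_rockafellar HC He He Hx Hr) as [y [ys [Hy [H1 H2]]]].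
  exists y, ys; split; [auto|].
  pose proof (epi_ge HC Hx) as Hge.
  replace (bminus x bzero) with x in HQ by vec. rewrite !dapp_0 in HQ.
  pose proof (bnorm_nonneg x) as Hm0. pose proof (dnorm_nonneg (dminus xs zs)) as Hn0.
  pose proof (bnorm_le_minus y x) as T1.
  pose proof (dnorm_minus_triangle xs ys zs) as T2.
  set (m := bnorm x) in *. set (n := dnorm (dminus xs zs)) in *.
  assert (A1 : Rabs (dminus xs zs (bminus y x)) <= n * (6 * e))
    by (apply dapp_le_norms; unfold n; lra).
  assert (A2 : Rabs (dminus ys xs y) <= 6 * e * (m + 6 * e)) by (apply dapp_le_norms; lra).
  assert (A3 : Rabs (zss (dminus ys zs)) <= K * (6 * e + n)).
  { eapply Rle_trans; [apply Hzss|]. apply Rmult_le_compat_l; lra. }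
  rewrite dminus_app, !dapp_minus in A1. rewrite dminus_app in A2. rewrite bdapp_minus in A3.
  pose proof (Rle_abs (ys y - xs y)).
  pose proof (Rle_abs (xs y - xs x - (zs y - zs x))).
  pose proof (Rle_abs (- (zss ys - zss zs))) as A4. rewrite Rabs_Ropp in A4.
  assert (B1 : - (s / 2) <= s / 2 * m ^ 2 - 6 * e * m).
  { replace (s / 2 * m ^ 2 - 6 * e * m) with (s / 2 * (m - 1) ^ 2 - s / 2) by (unfold e; field).
    pose proof (pow2_ge_0 (m - 1)); nra. }
  assert (B2 : - (s / 2 * (1 + K) ^ 2) <= / (2 * s) * n ^ 2 - (1 + K) * n).
  { replace (/ (2 * s) * n ^ 2 - (1 + K) * n)
      with (/ (2 * s) * (n - s * (1 + K)) ^ 2 - s / 2 * (1 + K) ^ 2) by (field; lra).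
    assert (0 <= / (2 * s) * (n - s * (1 + K)) ^ 2); [|lra].
    apply Rmult_le_pos; [apply Rlt_le, Rinv_0_lt_compat; lra | apply pow2_ge_0]. }
  assert (B3 : 37 * (e * e) <= 37 / 36 * s) by (unfold e; nra).
  assert (B4 : 6 * e * n <= n) by (unfold e; nra).
  assert (B5 : K * (6 * e + n) = K * s + K * n) by (unfold e; field).
  assert (B6 : s * (2 + K + (1 + K) ^ 2 / 2) < d).
  { apply Rlt_le_trans with (s * (3 * (1 + K) ^ 2 + d)); [|lra].
    apply Rmult_lt_compat_l; nra. }
  unfold d in *. lra.
Qed.

(** [C] touches the coupling at [(z, zs)] and stays above it, so along a segment leaving that point
    it cannot have the smaller slope; the quadratic remainder of the coupling vanishes with [t]. *)
Lemma contact_subgradient C z zs y ys q :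
  strong_epi C -> contact C z zs -> C y ys q -> zs y + ys z - zs z <= q.
Proof.
  intros HC Hz Hy. apply le_of_le_linear with (zs y + ys z - zs z - ys y). intros t Ht.
  pose proof (epi_ge HC (epi_convex HC Hy Hz (t := t) ltac:(lra))) as H.
  simpl in H. rewrite !dapp_add, !dapp_scal in H.
  apply Rmult_le_reg_l with t; [lra|]. nra.
Qed.

End Pair.

(** * Gossez type (D) *)

Section TypeD.
Variable X : Banach.
Implicit Types x y z : X.
Implicit Types xs ys zs f : dual X.
Implicit Types zss : bidual X.
Implicit Types F : list (dual X).

(** A penalty on one affine constraint becomes a linear term, by separation in the plane of the
    pairs [(f x - a, r)]: the slopes required where [f x > a] never exceed those allowed where
    [f x < a]. *)
Lemma multiplier (C : X -> dual X -> R -> Prop) (f : dual X) a A :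
  pair_convex C -> (forall x xs r, C x xs r -> 0 <= r + A * Rabs (f x - a)) ->
  exists m, forall x xs r, C x xs r -> 0 <= r + m * (f x - a).
Proof.
  intros HC Hpos.
  pose (U := fun u => exists x xs r, C x xs r /\ 0 < f x - a /\ u = - r / (f x - a)).
  destruct (classic (exists u, U u)) as [[u0 Hu0]|Hempty].
  - destruct (completeness U) as [m [Hub Hleast]].
    + exists A. intros u [x [xs [r [Hx [Hf ->]]]]].
      specialize (Hpos _ _ _ Hx). rewrite Rabs_pos_eq in Hpos by lra.
      apply Rmult_le_reg_r with (f x - a); [auto|].
      unfold Rdiv; rewrite Rmult_assoc, Rinv_l by lra. lra.
    + now exists u0.
    + exists m. intros x xs r Hx. destruct (Rtotal_order (f x - a) 0) as [Hf|[Hf|Hf]].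
      * assert (m <= r / (a - f x)).
        { apply Hleast. intros u [y [ys [q [Hy [Hg ->]]]]].
          set (p := f y - a) in *. set (n := a - f x). assert (Hn : 0 < n) by (unfold n; lra).
          (* This weight puts the combination on the hyperplane [f = a], where the penalty
             vanishes. *)
          pose proof (HC _ _ _ _ _ _ (n / (n + p)) Hy Hx) as Hz.
          assert (Ht : 0 <= n / (n + p) <= 1).
          { split; [apply Rlt_le, Rdiv_lt_0_compat; lra|].
            apply Rmult_le_reg_r with (n + p); [lra|].
            unfold Rdiv; rewrite Rmult_assoc, Rinv_l by lra. lra. }
          specialize (Hpos _ _ _ (Hz Ht)). rewrite dapp_add, !dapp_scal in Hpos.
          replace (n / (n + p) * f y + (1 - n / (n + p)) * f x - a) with 0 in Hpos.
          2: { replace (f y) with (p + a) by (unfold p; ring).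
               replace (f x) with (a - n) by (unfold n; ring). field; lra. }
          rewrite Rabs_R0, Rmult_0_r, Rplus_0_r in Hpos.
          apply (Rmult_le_compat_l (n + p)) in Hpos; [|lra].
          replace ((n + p) * (n / (n + p) * q + (1 - n / (n + p)) * r)) with (n * q + p * r)
            in Hpos by (field; lra).
          apply Rmult_le_reg_r with (n * p); [nra|].
          replace (- q / p * (n * p)) with (- q * n) by (field; lra).
          replace (r / n * (n * p)) with (r * p) by (field; lra). lra. }
        apply (Rmult_le_compat_r (a - f x)) in H; [|lra].
        unfold Rdiv in H; rewrite Rmult_assoc, Rinv_l in H by lra. lra.
      * specialize (Hpos _ _ _ Hx). rewrite Hf, Rabs_R0 in Hpos. rewrite Hf; lra.
      * assert (- r / (f x - a) <= m) by (apply Hub; exists x, xs, r; auto).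
        apply (Rmult_le_compat_r (f x - a)) in H; [|lra].
        unfold Rdiv in H; rewrite Rmult_assoc, Rinv_l in H by lra. lra.
  - exists (- A). intros x xs r Hx. specialize (Hpos _ _ _ Hx).
    assert (f x - a <= 0).
    { apply Rnot_lt_le; intro Hf. apply Hempty. now exists (- r / (f x - a)), x, xs, r. }
    rewrite Rabs_left1 in Hpos by lra. lra.
Qed.

Fixpoint weak_gap (zss : bidual X) (F : list (dual X)) (x : X) : R :=
  match F with
  | nil => 0
  | f :: F' => Rabs (f x - zss f) + weak_gap zss F' x
  end.

Lemma weak_gap_nonneg zss F x : 0 <= weak_gap zss F x.
Proof. induction F as [|f F IH]; simpl; [lra|]. pose proof (Rabs_pos (f x - zss f)); lra. Qed.

Lemma weak_gap_in zss F f x : In f F -> Rabs (f x - zss f) <= weak_gap zss F x.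
Proof.
  induction F as [|g F IH]; simpl; [easy|]. intros [->|H].
  - pose proof (weak_gap_nonneg zss F x); lra.
  - specialize (IH H). pose proof (Rabs_pos (g x - zss g)); lra.
Qed.

Lemma weak_gap_convex zss F x y t : 0 <= t <= 1 ->
  weak_gap zss F (badd (bscal t x) (bscal (1 - t) y))
    <= t * weak_gap zss F x + (1 - t) * weak_gap zss F y.
Proof.
  intro Ht. induction F as [|f F IH]; simpl; [lra|].
  rewrite dapp_add, !dapp_scal.
  replace (t * f x + (1 - t) * f y - zss f)
    with (t * (f x - zss f) + (1 - t) * (f y - zss f)) by ring.
  pose proof (Rabs_triang (t * (f x - zss f)) ((1 - t) * (f y - zss f))) as H.
  rewrite !Rabs_mult, (Rabs_pos_eq t), (Rabs_pos_eq (1 - t)) in H by lra. lra.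
Qed.

(** The gaps of the tail are added to the values while [multiplier] linearizes the head; since
    [weak_gap] is convex but not affine, this uses [<=] on the values. As [F] is finite, the
    resulting functional [w] lies in [dual X]. *)
Lemma multipliers (zss : bidual X) A F : 0 <= A -> forall (C : X -> dual X -> R -> Prop),
  pair_convex C -> (forall x xs r, C x xs r -> 0 <= r + A * weak_gap zss F x) ->
  exists w : dual X, forall x xs r, C x xs r -> 0 <= r + (w x - zss w).
Proof.
  intro HA. induction F as [|f F IH]; intros C HC Hpos.
  (* Zero written as a multiple, so that [bdapp_scal] evaluates [zss] at it. *)
  - exists (dscale 0 (dzero X)). intros x xs r Hx. specialize (Hpos _ _ _ Hx).
    rewrite bdapp_scal. simpl in *. lra.
  - destruct (@multiplier (fun x xs r => exists q, C x xs q /\ q + A * weak_gap zss F x <= r)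
      f (zss f) A) as [m Hm].
    + intros x xs r y ys q t [r' [Hx Hr]] [q' [Hy Hq]] Ht.
      exists (t * r' + (1 - t) * q'). split; [now apply HC|].
      pose proof (weak_gap_convex zss F x y Ht) as H.
      apply (Rmult_le_compat_l A) in H; [|auto]. nra.
    + intros x xs r [q [Hx Hq]]. specialize (Hpos _ _ _ Hx). simpl in Hpos. lra.
    + destruct (IH (fun x xs r => C x xs (r - m * (f x - zss f)))) as [w Hw].
      * intros x xs r y ys q t Hx Hy Ht. pose proof (HC _ _ _ _ _ _ t Hx Hy Ht) as H.
        rewrite dapp_add, !dapp_scal.
        match type of H with C _ _ ?u => match goal with |- C _ _ ?v =>
          replace v with u by ring end end. exact H.
      * intros x xs r Hx.
        assert (H : 0 <= r - m * (f x - zss f) + A * weak_gap zss F x + m * (f x - zss f)).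
        { apply (Hm x xs). exists (r - m * (f x - zss f)). split; [auto | lra]. }
        lra.
      * exists (dplus w (dscale m f)). intros x xs r Hx.
        rewrite bdapp_add, bdapp_scal. simpl.
        specialize (Hw x xs (r + m * (f x - zss f))).
        replace (r + m * (f x - zss f) - m * (f x - zss f)) with r in Hw by ring.
        specialize (Hw Hx). lra.
Qed.

Inductive hull (S : multifun X) : X -> dual X -> R -> Prop :=
| hull_graph x xs : S x xs -> hull S x xs (xs x)
| hull_comb x xs r y ys q t : hull S x xs r -> hull S y ys q -> 0 <= t <= 1 ->
    hull S (badd (bscal t x) (bscal (1 - t) y)) (dplus (dscale t xs) (dscale (1 - t) ys))
      (t * r + (1 - t) * q).

Lemma hull_contact C x xs r : strong_epi C -> hull (contact C) x xs r -> C x xs r.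
Proof. intros HC H. induction H; auto. now apply HC. Qed.

(** Membership in the Gossez closure is an inequality affine in [(x, xs, r)], so it passes from the
    graph to the hull. *)
Lemma hull_gossez S zss zs x xs r :
  gossez S zss zs -> hull S x xs r -> zs x + zss xs - r <= zss zs.
Proof.
  intros Hg H. induction H as [x xs H|x xs r y ys q t _ IH1 _ IH2 Ht].
  - specialize (Hg _ _ H). rewrite bdapp_minus, dminus_app in Hg. lra.
  - rewrite dapp_add, bdapp_add, !dapp_scal, !bdapp_scal. nra.
Qed.

Lemma hull_conj C (ws : dual X) (wss : bidual X) k :
  strong_epi C -> (forall x xs r, hull (contact C) x xs r -> ws x + wss xs - r <= k) ->
  wss ws <= k.
Proof.
  intros HC H. apply Rnot_lt_le; intro Hlt.
  destruct (contact_conj HC Hlt) as [y [ys [Hy Hk]]].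
  specialize (H y ys _ (hull_graph Hy)). lra.
Qed.

(* The conjugate of the hull dominates the duality product and touches it at [(zs, zss)],
   so its epigraph lies above the tangent there. *)
Lemma hull_biconj C (zs : dual X) (zss : bidual X) (ws : dual X) (wss : bidual X) k :
  strong_epi C -> gossez (contact C) zss zs ->
  (forall x xs r, hull (contact C) x xs r -> ws x + wss xs - r <= k) ->
  zss ws + wss zs - zss zs <= k.
Proof.
  intros HC Hg H. apply le_of_le_linear with (zss ws + wss zs - zss zs - wss ws). intros t Ht.
  assert (Hb : exists G : bidual X, forall f, G f = t * wss f + (1 - t) * zss f).
  { destruct (bdapp_bound wss) as [K1 [_ H1]]. destruct (bdapp_bound zss) as [K2 [_ H2]].
    unshelve eexists (@mkBidual X (fun f => t * wss f + (1 - t) * zss f) _ _ _); [| | |easy].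
    - intros; cbv beta; rewrite !bdapp_add; ring.
    - intros; cbv beta; rewrite !bdapp_scal; ring.
    - exists (t * K1 + (1 - t) * K2). intro f.
      eapply Rle_trans; [apply Rabs_triang|].
      rewrite !Rabs_mult, (Rabs_pos_eq t), (Rabs_pos_eq (1 - t)) by lra.
      specialize (H1 f); specialize (H2 f). nra. }
  destruct Hb as [G HG].
  assert (Hc : G (dplus (dscale t ws) (dscale (1 - t) zs)) <= t * k + (1 - t) * zss zs).
  { apply (hull_conj HC). intros x xs r Hx. specialize (H _ _ _ Hx).
    pose proof (hull_gossez Hg Hx). rewrite HG. simpl. nra. }
  rewrite HG, !bdapp_add, !bdapp_scal in Hc.
  apply Rmult_le_reg_l with t; [lra|]. nra.
Qed.

(** A separation of Goldstine type. If the penalized values stayed above [e], [multipliers] and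
    [sandwich_pair] would produce a functional [v] exceeding [zss v + e] on the ball of radius [K],
    against the bound [K] on [zss]. *)
Lemma hull_approx C (zs : dual X) (zss : bidual X) K F e :
  strong_epi C -> gossez (contact C) zss zs ->
  0 < K -> (forall f, Rabs (zss f) <= K * dnorm f) -> 0 < e ->
  exists x xs r, hull (contact C) x xs r /\
    r - zss zs + (K + 2) * weak_gap zss F x + (K + 2) * dnorm (dminus xs zs)
      + (K + 2) * Rmax 0 (bnorm x - K) < e.
Proof.
  intros HC Hg HK Hzss He. apply NNPP; intro Hn.
  (* The separation works with any positive weight; [K + 2] lets the penalties absorb errors of the
     form [zss (xs - zs)] when the lemma is applied. *)
  set (A := K + 2) in *. assert (HA : 0 < A) by (unfold A; lra).
  pose (h := fun x xs => - zss zs - e + A * dnorm (dminus xs zs) + A * Rmax 0 (bnorm x - K)).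
  assert (Hh : pair_convex_fun h).
  { intros x xs y ys t Ht. unfold h.
    pose proof (convex_norm_minus (xs : dualB X) (ys : dualB X) (zs : dualB X) Ht) as H1.
    change (dnorm (dminus (dplus (dscale t xs) (dscale (1 - t) ys)) zs)
       <= t * dnorm (dminus xs zs) + (1 - t) * dnorm (dminus ys zs)) in H1.
    pose proof (bnorm_comb x y Ht) as H2.
    assert (H3 : Rmax 0 (bnorm (badd (bscal t x) (bscal (1 - t) y)) - K)
       <= t * Rmax 0 (bnorm x - K) + (1 - t) * Rmax 0 (bnorm y - K)).
    { pose proof (Rmax_l 0 (bnorm x - K)); pose proof (Rmax_r 0 (bnorm x - K)).
      pose proof (Rmax_l 0 (bnorm y - K)); pose proof (Rmax_r 0 (bnorm y - K)).
      apply Rmax_lub; nra. }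
    apply (Rmult_le_compat_l A) in H1; [|lra]. apply (Rmult_le_compat_l A) in H3; [|lra]. lra. }
  destruct (@multipliers zss A F (Rlt_le _ _ HA)
    (fun x xs r => exists q, hull (contact C) x xs q /\ q + h x xs <= r)) as [w Hw].
  { intros x xs r y ys q t [r' [Hx Hr]] [q' [Hy Hq]] Ht.
    exists (t * r' + (1 - t) * q'). split; [now apply hull_comb|].
    specialize (Hh x xs y ys t Ht). nra. }
  { intros x xs r [q [Hx Hq]]. apply Rnot_lt_le; intro Hlt. apply Hn.
    exists x, xs, q. split; [auto|]. unfold h in Hq. lra. }
  destruct (@contact_conj X C (dzero X) (J bzero) (-1) HC) as [x0 [xs0 [H0 _]]]; [simpl; lra|].
  destruct (@sandwich_pair X (hull (contact C)) (fun x xs => h x xs + (w x - zss w)) x0 xs0 (xs0 x0)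
    (- zss zs - e + A * (dnorm (dminus xs0 zs) + 1) + A * (bnorm x0 + 1)
       + (dnorm w * (bnorm x0 + 1) - zss w))) as [ws [wss Hws]].
  - exact (@hull_comb (contact C)).
  - intros x xs y ys t Ht. specialize (Hh x xs y ys t Ht). cbv beta.
    rewrite dapp_add, !dapp_scal. lra.
  - now apply hull_graph.
  - intros y ys Hy Hys. unfold h.
    pose proof (bnorm_le_minus y x0) as B1. pose proof (dnorm_minus_triangle xs0 ys zs) as B2.
    assert (B3 : Rabs (w y) <= dnorm w * (bnorm x0 + 1)) by (apply dapp_le_norms; lra).
    pose proof (Rle_abs (w y)).
    assert (B4 : Rmax 0 (bnorm y - K) <= bnorm x0 + 1).
    { apply Rmax_lub; [pose proof (bnorm_nonneg x0)|]; lra. }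
    apply (Rmult_le_compat_l A) in B4; [|lra].
    assert (A * dnorm (dminus ys zs) <= A * (dnorm (dminus xs0 zs) + 1))
      by (apply Rmult_le_compat_l; lra).
    lra.
  - intros x xs r Hx.
    specialize (Hw x xs (r + h x xs)). cbv beta.
    assert (0 <= r + h x xs + (w x - zss w)); [|lra].
    apply Hw. exists r; split; [auto | lra].
  (* At [(y, zs)] with [bnorm y <= K] both norm penalties in [h] vanish, and [hull_biconj] leaves an
     inequality between [v y] and [zss v]. *)
  - pose (v := dplus w ws).
    assert (Hv : forall y, bnorm y <= K -> zss v + e <= v y).
    { intros y Hy.
      pose proof (@hull_biconj C zs zss ws wss (h y zs + (w y - zss w) + ws y + wss zs) HC Hg) as H.
      assert (Hb : zss ws + wss zs - zss zs <= h y zs + (w y - zss w) + ws y + wss zs).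
      { apply H. intros x xs r Hx. apply Hws; auto. }
      unfold h in Hb. rewrite (Rmax_left 0 (bnorm y - K)) in Hb by lra.
      rewrite (bminus_diag_norm (E := dualB X) zs : dnorm (dminus zs zs) = 0) in Hb. unfold v. rewrite bdapp_add. simpl. lra. }
    assert (Hk : dnorm v <= (- zss v - e) / K).
    { assert (Hnn : 0 <= (- zss v - e) / K).
      { specialize (Hv bzero). rewrite bnorm_0, dapp_0 in Hv. specialize (Hv (Rlt_le _ _ HK)).
        apply Rmult_le_pos; [lra | apply Rlt_le, Rinv_0_lt_compat; auto]. }
      apply dnorm_le; [auto|]. intro p.
      destruct (Req_dec (bnorm p) 0) as [Hp|Hp].
      - apply bnorm_eq0 in Hp; subst p. rewrite dapp_0, bnorm_0, Rabs_R0; lra.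
      - assert (Hp' : 0 < bnorm p) by (pose proof (bnorm_nonneg p); lra).
        assert (Hs : forall s, Rabs s = 1 -> - (s * v p) <= (- zss v - e) / K * bnorm p).
        { intros s Hs. specialize (Hv (bscal (s * K / bnorm p) p)).
          rewrite bnorm_scal, dapp_scal in Hv.
          unfold Rdiv in Hv at 1. rewrite !Rabs_mult, Hs, (Rabs_pos_eq K) in Hv by lra.
          rewrite Rabs_pos_eq in Hv by (apply Rlt_le, Rinv_0_lt_compat; auto).
          rewrite Rmult_assoc, Rinv_l in Hv by lra. specialize (Hv ltac:(lra)).
          apply Rmult_le_reg_l with (K / bnorm p); [apply Rdiv_lt_0_compat; lra|].
          replace (K / bnorm p * ((- zss v - e) / K * bnorm p)) with (- zss v - e) by (field; lra).
          replace (K / bnorm p * - (s * v p)) with (- (s * K / bnorm p * v p)) by (field; lra).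
          lra. }
        pose proof (Hs 1 Rabs_R1) as H1. pose proof (Hs (-1)) as H2.
        rewrite Rabs_left in H2 by lra. specialize (H2 ltac:(lra)).
        apply Rabs_le; lra. }
    apply (Rmult_le_compat_l K) in Hk; [|lra].
    replace (K * ((- zss v - e) / K)) with (- zss v - e) in Hk by (field; lra).
    specialize (Hzss v). pose proof (Rle_abs (- zss v)) as H. rewrite Rabs_Ropp in H. lra.
Qed.

Lemma gossez_contact_approx C (zs : dual X) (zss : bidual X) K F e :
  strong_epi C -> gossez (contact C) zss zs ->
  0 < K -> (forall f, Rabs (zss f) <= K * dnorm f) -> 0 < e ->
  exists y ys, contact C y ys /\ bnorm y <= K + 2 /\ dnorm (dminus ys zs) <= e /\
    forall f, In f F -> Rabs (f y - zss f) <= e.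
Proof.
  intros HC Hg HK Hzss He.
  assert (HB : exists B, 0 <= B /\ forall f, In f F -> dnorm f <= B).
  { clear. induction F as [|f F [B [HB H]]]; [exists 0; split; [lra | easy]|].
    exists (dnorm f + B). pose proof (dnorm_nonneg f). split; [lra|].
    intros g [<-|Hin]; [lra|]. specialize (H g Hin); lra. }
  destruct HB as [B [HB HF]].
  (* [broendsted_rockafellar] moves each variable by [6 * d]: the first bound keeps [y] in the ball
     of radius [K + 2], the second keeps the functionals of [F], of norm at most [B], within [e]. *)
  pose (d := Rmin (/ 6) (e / (12 * (1 + B)))).
  assert (Hd : 0 < d) by (apply Rmin_glb_lt; [lra | apply Rdiv_lt_0_compat; lra]).
  assert (Hd1 : d <= / 6) by apply Rmin_l.
  assert (Hd2 : 12 * (d * (1 + B)) <= e).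
  { assert (H : d <= e / (12 * (1 + B))) by apply Rmin_r.
    apply (Rmult_le_compat_r (12 * (1 + B))) in H; [|lra].
    unfold Rdiv in H; rewrite Rmult_assoc, Rinv_l in H by lra. lra. }
  (* The gap [r - xs x] collects [n] from [r], [n] from the weak gap at [zs] and [n * (K + 1)] from
     [xs - zs]: in all [d * d]. *)
  pose (n := d * d / (K + 3)).
  assert (Hn : 0 < n) by (apply Rdiv_lt_0_compat; nra).
  assert (HnK : n * (K + 3) = d * d) by (unfold n; field; lra).
  assert (Hnd : n <= d) by nra.
  (* [zs] joins the list so that [zs x] is compared with [zss zs]; otherwise the gap at [x] would
     not be controlled. *)
  destruct (@hull_approx C zs zss K (zs :: F) n HC Hg HK Hzss Hn) as [x [xs [r [Hx Hr]]]].
  pose proof (hull_gossez Hg Hx) as Hlow. pose proof (hull_contact HC Hx) as HCx.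
  assert (Hdiff : Rabs (zss (dminus xs zs)) <= K * dnorm (dminus xs zs)) by apply Hzss.
  rewrite bdapp_minus in Hdiff. simpl in Hr.
  pose proof (Rle_abs (- (zss xs - zss zs))) as Ha. rewrite Rabs_Ropp in Ha.
  pose proof (Rle_abs (- (zs x - zss zs))) as Hb. rewrite Rabs_Ropp in Hb.
  pose proof (Rabs_pos (zs x - zss zs)) as Hu0. set (u := Rabs (zs x - zss zs)) in *.
  pose proof (weak_gap_nonneg zss F x) as Hg0. set (g := weak_gap zss F x) in *.
  pose proof (dnorm_nonneg (dminus xs zs)) as Hm0. set (m := dnorm (dminus xs zs)) in *.
  pose proof (Rmax_l 0 (bnorm x - K)) as Hk0. pose proof (Rmax_r 0 (bnorm x - K)) as Hk1.
  set (k := Rmax 0 (bnorm x - K)) in *.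
  assert (P1 : 0 <= K * u) by nra. assert (P2 : 0 <= K * g) by nra.
  assert (P3 : 0 <= K * k) by nra. assert (P4 : 0 <= K * m) by nra.
  assert (Hun : u <= n) by lra. assert (Hgn : g <= n) by lra.
  assert (Hmn : m <= n) by lra. assert (Hkn : k <= n) by lra.
  assert (Hrn : r <= zss zs + n) by lra.
  assert (Hxs : Rabs (dminus xs zs x) <= n * (K + 1)).
  { apply dapp_le_norms; [exact Hmn | lra]. }
  rewrite dminus_app in Hxs. pose proof (Rle_abs (- (xs x - zs x))) as Hc. rewrite Rabs_Ropp in Hc.
  destruct (@broendsted_rockafellar X C x xs r d d HC Hd Hd HCx) as [y [ys [Hy [H1 H2]]]]; [lra|].
  exists y, ys. split; [auto | split; [|split]].
  - pose proof (bnorm_le_minus y x). lra.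
  - pose proof (dnorm_minus_triangle xs ys zs) as T. fold m in T. nra.
  - intros f Hf. pose proof (weak_gap_in zss x Hf) as Hfx. fold g in Hfx.
    assert (Hfy : Rabs (f (bminus y x)) <= B * (6 * d)) by (apply dapp_le_norms; auto).
    rewrite dapp_minus in Hfy.
    replace (f y - zss f) with ((f y - f x) + (f x - zss f)) by ring.
    eapply Rle_trans; [apply Rabs_triang|]. nra.
Qed.

Lemma contact_gossez_D (C : X -> dual X -> R -> Prop) : strong_epi C -> gossez_D (contact C).
Proof.
  intro HC. split; [now apply contact_maximal|].
  intros zss zs Hg. destruct (bdapp_bound zss) as [K0 [HK0 Hzss0]].
  pose (K := K0 + 1). assert (HK : 0 < K) by (unfold K; lra).
  assert (Hzss : forall f, Rabs (zss f) <= K * dnorm f).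
  { intro f. specialize (Hzss0 f). pose proof (dnorm_nonneg f). unfold K; lra. }
  assert (He : forall n, 0 < / INR (S n)) by (intro; apply Rinv_0_lt_compat, lt_0_INR; lia).
  assert (Hpt : forall i : list (dual X) * nat, exists p : X * dual X,
    contact C (fst p) (snd p) /\ bnorm (fst p) <= K + 2 /\
    dnorm (dminus (snd p) zs) <= / INR (S (snd i)) /\
    forall f, In f (fst i) -> Rabs (f (fst p) - zss f) <= / INR (S (snd i))).
  { intros [F n]. destruct (@gossez_contact_approx C zs zss K F _ HC Hg HK Hzss (He n))
      as [y [ys Hy]]. now exists (y, ys). }
  apply choice in Hpt. destruct Hpt as [p Hp].
  assert (Hsmall : forall e, 0 < e -> exists N, forall n, (N <= n)%nat -> / INR (S n) < e).
  { intros e Hpos. destruct (archimed_cor1 e Hpos) as [N [HN HN0]]. exists N; intros n Hn.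
    eapply Rle_lt_trans; [|exact HN]. apply Rinv_le_contravar; [now apply lt_0_INR|].
    apply le_INR; lia. }
  (* An index is a finite list of functionals to be approximated and a precision; larger lists and
     precisions come later. *)
  exists (list (dual X) * nat)%type,
    (fun i j => incl (fst i) (fst j) /\ (snd i <= snd j)%nat),
    (fun i => fst (p i)), (fun i => snd (p i)).
  split; [|split; [|split; [|split]]].
  - split; [exact (inhabits (nil, O))|]. split; [|split].
    + intro i; split; [apply incl_refl | lia].
    + intros i j k [H1 H2] [H3 H4]; split; [eapply incl_tran; eauto | lia].
    + intros i j. exists (fst i ++ fst j, Nat.max (snd i) (snd j)); simpl.
      split; split; try lia; [apply incl_appl | apply incl_appr]; apply incl_refl.
  - intro i; apply Hp.
  - exists (K + 2 + dnorm zs + 1). intro i. destruct (Hp i) as [_ [H1 [H2 _]]].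
    pose proof (dnorm_nonneg zs). split; [lra|].
    pose proof (dnorm_le_minus (snd (p i)) zs).
    assert (/ INR (S (snd i)) <= 1).
    { rewrite <- Rinv_1. apply Rinv_le_contravar; [lra|]. apply (le_INR 1); lia. }
    lra.
  - intros f e Hpos. destruct (Hsmall e Hpos) as [N HN]. exists (f :: nil, N).
    intros i [H1 H2]; simpl in *. destruct (Hp i) as [_ [_ [_ H]]].
    eapply Rle_lt_trans; [apply H, H1; now left | now apply HN].
  - intros e Hpos. destruct (Hsmall e Hpos) as [N HN]. exists (nil, N).
    intros i [_ H2]; simpl in *. destruct (Hp i) as [_ [_ [H _]]].
    rewrite Rminus_0_r, Rabs_pos_eq by apply dnorm_nonneg.
    eapply Rle_lt_trans; [apply H | now apply HN].
Qed.

End TypeD.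

(** * The Robinson-Ursescu theorem on a closed subspace *)

Definition norm_closed (E : Banach) (A : E -> Prop) :=
  forall x, (forall e, 0 < e -> exists y, A y /\ bnorm (bminus y x) < e) -> A x.

Definition convex_set (E : Banach) (A : E -> Prop) :=
  forall x y t, A x -> A y -> 0 <= t <= 1 -> A (badd (bscal t x) (bscal (1 - t) y)).

Definition subspace (E : Banach) (L : E -> Prop) :=
  L bzero /\ (forall x y, L x -> L y -> L (badd x y)) /\ (forall a x, L x -> L (bscal a x)).

Definition bounded_linear (E F : Banach) (p : E -> F) :=
  (forall x y, p (badd x y) = badd (p x) (p y)) /\ (forall a x, p (bscal a x) = bscal a (p x)) /\
  exists k, 0 <= k /\ forall x, bnorm (p x) <= k * bnorm x.

(** Baire's theorem relative to the closed set [L]. The conclusion is density of [A n] in a relative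
    ball, so no [A n] has to be closed. *)
Lemma baire (E : Banach) (L : E -> Prop) (A : nat -> E -> Prop) :
  norm_closed L -> (exists x, L x) -> (forall x, L x -> exists n, A n x) ->
  exists n x0 r, L x0 /\ 0 < r /\ forall x, L x -> bnorm (bminus x x0) <= r ->
    forall e, 0 < e -> exists y, A n y /\ bnorm (bminus y x) < e.
Proof.
  intros HL [a0 Ha0] Hcov. apply NNPP; intro Hn.
  assert (Hstep : forall n x0 r, L x0 -> 0 < r -> exists x e, L x /\ bnorm (bminus x x0) <= r /\
            0 < e /\ forall y, A n y -> e <= bnorm (bminus y x)).
  { intros n x0 r Hx0 Hr. apply NNPP; intro Hn'. apply Hn. exists n, x0, r.
    repeat split; auto. intros x Hx Hxr e He. apply NNPP; intro Hn''. apply Hn'.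
    exists x, e; repeat split; auto. intros y Hy. apply Rnot_lt_le; intro Hlt.
    apply Hn''; now exists y. }
  destruct (@dependent_choice (E * R) (fun n p => L (fst p) /\ 0 < snd p <= (/ 2) ^ n)
    (fun n p q => bnorm (bminus (fst q) (fst p)) <= snd p / 2 /\ snd q <= snd p / 2 /\
       forall y, A n y -> 2 * snd q <= bnorm (bminus y (fst q))) (a0, 1)) as [u [_ Hu]].
  - simpl; split; [auto | lra].
  - intros n [x r]; simpl; intros [Hx [Hr Hrn]].
    destruct (Hstep n x (r / 2) Hx ltac:(lra)) as [y [e [Hy [Hyx [He Hye]]]]].
    (* [e / 2] puts [A n] at twice the new radius from the center, so the limit, which stays within
       one radius, is not in [A n]. *)
    exists (y, Rmin (e / 2) (r / 2)); simpl.
    pose proof (Rmin_l (e / 2) (r / 2)); pose proof (Rmin_r (e / 2) (r / 2)).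
    repeat split; auto; try lra.
    + apply Rmin_glb_lt; lra.
    + intros z Hz. specialize (Hye z Hz). lra.
  - destruct (@geometric_cauchy E (fun n => fst (u n)) 1) as [l Hl].
    { intro n. destruct (Hu n) as [[_ H1] [H2 _]]. lra. }
    assert (Hdist : forall n k, bnorm (bminus (fst (u (n + k)%nat)) (fst (u n)))
                      <= snd (u n) - snd (u (n + k)%nat)).
    { intros n k; induction k as [|k IH].
      - rewrite Nat.add_0_r, bminus_diag_norm; lra.
      - rewrite Nat.add_succ_r. destruct (Hu (n + k)%nat) as [_ [H1 [H2 _]]].
        pose proof (bnorm_minus_triangle (fst (u (n + k)%nat)) (fst (u (S (n + k)))) (fst (u n))).
        lra. }
    assert (Hball : forall n, bnorm (bminus l (fst (u n))) <= snd (u n)).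
    { intro n. apply le_epsilon; intros e He.
      destruct (half_pow_small (2 * 1) He) as [N HN].
      specialize (HN (n + N)%nat ltac:(lia)). specialize (Hl (n + N)%nat). specialize (Hdist n N).
      destruct (Hu (n + N)%nat) as [[_ H1] _].
      pose proof (bnorm_minus_triangle (fst (u (n + N)%nat)) l (fst (u n))).
      rewrite (bnorm_minusC l (fst (u (n + N)%nat))) in H. lra. }
    assert (HLl : L l).
    { apply HL. intros e He. destruct (half_pow_small (2 * 1) He) as [N HN].
      exists (fst (u N)). split; [apply Hu|]. eapply Rle_lt_trans; [apply Hl | apply HN; lia]. }
    destruct (Hcov l HLl) as [n Hln]. destruct (Hu n) as [_ [_ [_ H]]]. specialize (H l Hln).
    specialize (Hball (S n)). destruct (Hu (S n)) as [[_ H1] _]. lra.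
Qed.

(** The open mapping argument for a closed convex set: Baire gives approximate preimages near some
    [x0], convexity moves [x0] to the origin, and a convex series makes the preimages exact. Their
    bound [N] later bounds a value function. *)
Lemma robinson_ursescu (Z F : Banach) (p : Z -> F) (C : Z -> Prop) (L : F -> Prop) (u : F) :
  bounded_linear p -> convex_set C -> norm_closed C -> subspace L -> norm_closed L ->
  (forall z, C z -> L (bminus (p z) u)) ->
  (forall x, L x -> exists d, 0 < d /\ forall l, 0 <= l <= d ->
     exists z, C z /\ p z = badd u (bscal l x)) ->
  exists rho N, 0 < rho /\ forall v, L v -> bnorm v <= rho ->
    exists z, C z /\ bnorm z <= N /\ p z = badd u v.
Proof.
  intros [Hpa [Hps [k [Hk0 Hpk]]]] HC HCc [HL0 [HLa HLs]] HLc HCL Habs.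
  assert (Hcomb : forall z1 z2 t, p (badd (bscal t z1) (bscal (1 - t) z2))
            = badd (bscal t (p z1)) (bscal (1 - t) (p z2))) by (intros; now rewrite Hpa, !Hps).
  assert (Hz0 : exists z0, C z0 /\ p z0 = u).
  { destruct (Habs bzero HL0) as [d [Hd H]]. destruct (H 0 ltac:(lra)) as [z [Hz Hpz]].
    exists z; split; [auto|]. rewrite Hpz. vec. }
  destruct Hz0 as [z0 [Hz0 Hpz0]].
  destruct (@baire F L (fun n x => exists z, C z /\ bnorm z <= INR n /\
      p z = badd u (bscal (/ INR (S n)) x))) as [n [x0 [r [Hx0 [Hr Hball]]]]]; auto.
  { now exists bzero. }
  { intros x Hx. destruct (Habs x Hx) as [d [Hd H]].
    destruct (archimed_cor1 d Hd) as [m [Hm Hm0]].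
    assert (HINRm : 0 < INR m) by now apply lt_0_INR.
    destruct (H (/ INR m)) as [z [Hz Hpz]].
    { split; [apply Rlt_le, Rinv_0_lt_compat; auto | lra]. }
    destruct (INR_unbounded (Rmax (bnorm z) (bnorm z0))) as [n1 Hn1].
    pose proof (Rmax_l (bnorm z) (bnorm z0)); pose proof (Rmax_r (bnorm z) (bnorm z0)).
    pose (n := Nat.max n1 m). exists n.
    assert (Hnn : INR n1 <= INR n) by (apply le_INR; unfold n; lia).
    assert (Hmn : INR m <= INR (S n)) by (apply le_INR; unfold n; lia).
    (* Mixing with [z0], which lies over [u], shortens the step [/ INR m] to [/ INR (S n)]. *)
    pose (t := INR m / INR (S n)).
    assert (Ht : 0 <= t <= 1).
    { split; [apply Rlt_le, Rdiv_lt_0_compat; lra|].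
      apply Rmult_le_reg_r with (INR (S n)); [lra|].
      unfold t, Rdiv; rewrite Rmult_assoc, Rinv_l by lra. lra. }
    exists (badd (bscal t z) (bscal (1 - t) z0)). split; [now apply HC | split].
    - eapply Rle_trans; [apply bnorm_comb; auto|]. nra.
    - rewrite Hcomb, Hpz, Hpz0. unfold t. assert (0 < INR (S n)) by lra.
      set (i := INR (S n)) in *. set (j := INR m) in *. vec. }
  set (s := / INR (S n)) in *.
  assert (Hs : 0 < s) by (apply Rinv_0_lt_compat, lt_0_INR; lia).
  destruct (Habs (bscal (-1) x0) (HLs _ _ Hx0)) as [d [Hd H]].
  destruct (H d ltac:(lra)) as [z1 [Hz1 Hpz1]]. clear H.
  pose (M := Rmax (INR n) (bnorm z1)).
  pose proof (Rmax_l (INR n) (bnorm z1)) as HM1. pose proof (Rmax_r (INR n) (bnorm z1)) as HM2.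
  fold M in HM1, HM2.
  (* [z1] lies over a point opposite to [x0]; with this weight [(1 - t) * d = t * s], so [x0]
     cancels. *)
  pose (t := d / (s + d)).
  assert (Ht : 0 < t) by (apply Rdiv_lt_0_compat; lra).
  assert (Ht1 : t <= 1).
  { apply Rmult_le_reg_r with (s + d); [lra|].
    unfold t, Rdiv; rewrite Rmult_assoc, Rinv_l by lra. lra. }
  pose (rho := t * s * r). assert (Hts : 0 < t * s) by nra.
  assert (Hrho : 0 < rho) by (unfold rho; nra).
  assert (Happ : forall v, L v -> bnorm v <= rho -> forall e, 0 < e ->
            exists z, C z /\ bnorm z <= M /\ bnorm (bminus (p z) (badd u v)) < e).
  { intros v Hv Hvr e He.
    destruct (Hball (badd x0 (bscal (/ (t * s)) v))) with (e := e / (t * s)) as [y [[z [Hz [Hzn Hpz]]] Hy]].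
    - auto.
    - replace (bminus (badd x0 (bscal (/ (t * s)) v)) x0) with (bscal (/ (t * s)) v) by vec.
      rewrite bnorm_scal_pos by (apply Rlt_le, Rinv_0_lt_compat; auto).
      apply Rmult_le_reg_l with (t * s); [auto|].
      rewrite <- Rmult_assoc, Rinv_r, Rmult_1_l by lra. exact Hvr.
    - apply Rdiv_lt_0_compat; lra.
    - exists (badd (bscal t z) (bscal (1 - t) z1)). split; [apply HC; auto; lra | split].
      + eapply Rle_trans; [apply bnorm_comb; lra|]. nra.
      + rewrite Hcomb, Hpz, Hpz1.
        replace (bminus (badd (bscal t (badd u (bscal s y)))
            (bscal (1 - t) (badd u (bscal d (bscal (-1) x0))))) (badd u v))
          with (bscal (t * s) (bminus y (badd x0 (bscal (/ (t * s)) v)))).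
        * rewrite bnorm_scal_pos by lra. apply (Rmult_lt_compat_l (t * s)) in Hy; [|auto].
          replace (t * s * (e / (t * s))) with e in Hy by (field; lra). exact Hy.
        * assert (Htd : (1 - t) * d = t * s) by (unfold t; field; lra).
          vec; lra. }
  (* Half the radius, because each step below approximates at twice the current remainder. *)
  exists (rho / 2), M. split; [lra|]. intros v0 Hv0 Hv0r.
  pose (CM := fun z => C z /\ bnorm z <= M).
  (* [w] is a partial sum of [sum_n 2^-n z_n] with [z_n] in [CM]; the invariant says that
     any [c] in [CM] completes it to a convex combination. *)
  destruct (@dependent_choice (Z * F)
    (fun m q => L (snd q) /\ bnorm (snd q) <= rho / 2 /\
      (forall c, CM c -> CM (badd (fst q) (bscal ((/ 2) ^ m) c))) /\
      badd (p (fst q)) (bscal ((/ 2) ^ m) (badd u (snd q))) = badd u v0)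
    (fun m q q' => bnorm (bminus (fst q') (fst q)) <= M * (/ 2) ^ m) (bzero, v0)) as [w [_ Hw]].
  - simpl. split; [auto | split; [auto | split]].
    + intros c Hc. replace (badd bzero (bscal 1 c)) with c by vec. exact Hc.
    + replace (p bzero) with (bzero : F); [vec|].
      rewrite <- (bscal_0 (bzero : Z)), Hps. now rewrite bscal_0.
  - intros m [w v]; simpl; intros [Hv [Hvr [Hinv Heq]]].
    destruct (Happ (bscal 2 v)) with (e := rho / 2) as [z [Hz [HzM Hpz]]]; auto; try lra.
    { rewrite bnorm_scal_pos; lra. }
    set (h := (/ 2) ^ m) in *. assert (Hh : 0 < h) by apply half_pow_pos.
    exists (badd w (bscal (/ 2 * h) z), bminus (badd u (bscal 2 v)) (p z)); simpl.
    split; [split; [|split; [|split]]|].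
    + replace (bminus (badd u (bscal 2 v)) (p z))
        with (badd (bscal (-1) (bminus (p z) u)) (bscal 2 v)) by vec.
      apply HLa; auto.
    + rewrite bnorm_minusC. lra.
    + intros c Hc.
      replace (badd (badd w (bscal (/ 2 * h) z)) (bscal (/ 2 * h) c))
        with (badd w (bscal h (badd (bscal (/ 2) z) (bscal (1 - / 2) c)))) by vec.
      apply Hinv. destruct Hc as [Hc1 Hc2]. split; [apply HC; auto; lra|].
      eapply Rle_trans; [apply bnorm_comb; lra|]. lra.
    + rewrite Hpa, Hps, <- Heq. vec.
    + replace (bminus (badd w (bscal (/ 2 * h) z)) w) with (bscal (/ 2 * h) z) by vec.
      rewrite bnorm_scal_pos by lra. pose proof (bnorm_nonneg z). nra.
  - destruct (@geometric_cauchy Z (fun m => fst (w m)) M) as [l Hl]; [intro; apply Hw|].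
    destruct (Happ bzero HL0) with (e := 1) as [c [Hc [HcM _]]];
      [rewrite bnorm_0; lra | lra |].
    assert (HM0 : 0 <= M) by (pose proof (bnorm_nonneg c); lra).
    exists l. split; [|split].
    + apply HCc. intros e He. destruct (half_pow_small (3 * M) He) as [m Hm].
      specialize (Hm m (le_n _)). destruct (Hw m) as [[_ [_ [Hinv _]]] _].
      exists (badd (fst (w m)) (bscal ((/ 2) ^ m) c)). split; [now apply Hinv|].
      replace (bminus (badd (fst (w m)) (bscal ((/ 2) ^ m) c)) l)
        with (badd (bminus (fst (w m)) l) (bscal ((/ 2) ^ m) c)) by vec.
      eapply Rle_lt_trans; [apply bnorm_triangle|].
      pose proof (half_pow_pos m). rewrite bnorm_scal_pos by lra. specialize (Hl m). nra.
    + apply le_epsilon. intros e He. destruct (half_pow_small (3 * M) He) as [m Hm].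
      specialize (Hm m (le_n _)). destruct (Hw m) as [[_ [_ [Hinv _]]] _].
      destruct (Hinv c (conj Hc HcM)) as [_ Hn].
      pose proof (bnorm_le_minus l (badd (fst (w m)) (bscal ((/ 2) ^ m) c))) as H.
      replace (bminus l (badd (fst (w m)) (bscal ((/ 2) ^ m) c)))
        with (badd (bminus l (fst (w m))) (bscal (- (/ 2) ^ m) c)) in H by vec.
      pose proof (bnorm_triangle (bminus l (fst (w m))) (bscal (- (/ 2) ^ m) c)) as H1.
      rewrite bnorm_scal, Rabs_Ropp, Rabs_pos_eq, bnorm_minusC in H1
        by (apply Rlt_le, half_pow_pos).
      pose proof (half_pow_pos m). specialize (Hl m). nra.
    + apply bnorm_small_eq. intros e He.
      destruct (half_pow_small (k * (2 * M) + (bnorm u + rho)) He) as [m Hm].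
      specialize (Hm m (le_n _)). destruct (Hw m) as [[_ [Hvm [_ Heq]]] _].
      rewrite <- Heq.
      replace (bminus (p l) (badd (p (fst (w m))) (bscal ((/ 2) ^ m) (badd u (snd (w m))))))
        with (badd (p (badd l (bscal (-1) (fst (w m))))) (bscal (- (/ 2) ^ m) (badd u (snd (w m)))))
        by (rewrite Hpa, Hps; vec).
      eapply Rle_trans; [apply bnorm_triangle|].
      rewrite bnorm_scal, Rabs_Ropp, Rabs_pos_eq by (apply Rlt_le, half_pow_pos).
      pose proof (Hpk (badd l (bscal (-1) (fst (w m))))) as H1.
      rewrite <- bopp_scal in H1. fold (bminus l (fst (w m))) in H1. rewrite bnorm_minusC in H1.
      rewrite <- bopp_scal. fold (bminus l (fst (w m))).
      pose proof (bnorm_triangle u (snd (w m))). pose proof (half_pow_pos m).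
      specialize (Hl m). assert (k * bnorm (bminus (fst (w m)) l) <= k * (2 * M * (/ 2) ^ m))
        by (apply Rmult_le_compat_l; auto).
      nra.
Qed.

(** * Affine hulls and relative interiors *)

Ltac dual_lin := apply dual_ext; intro; simpl; try ring; try (field; lra).

Section Affine.
Variable X : Banach.
Implicit Types A C D : dset X.
Implicit Types u v x y : dual X.

Lemma aff_incl A : dsubset A (aff A).
Proof. intros u Hu C _ HC; auto. Qed.

Lemma aff_daffine A : daffine (aff A).
Proof. intros u v t Hu Hv C HC HAC. apply HC; [now apply Hu | now apply Hv]. Qed.

Lemma aff_min A C : daffine C -> dsubset A C -> dsubset (aff A) C.
Proof. intros HC HAC u Hu. now apply Hu. Qed.

Lemma daffine_dconvex C : daffine C -> dconvex C.
Proof. intros H a b t Ha Hb _. now apply H. Qed.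

Lemma daffine_shift C u : daffine C -> daffine (fun x => C (dplus u x)).
Proof.
  intros HC a b t Ha Hb.
  replace (dplus u (dplus (dscale t a) (dscale (1 - t) b)))
    with (dplus (dscale t (dplus u a)) (dscale (1 - t) (dplus u b))) by dual_lin.
  now apply HC.
Qed.

Lemma daffine_reflect C u : daffine C -> daffine (fun x => C (dminus u x)).
Proof.
  intros HC a b t Ha Hb.
  replace (dminus u (dplus (dscale t a) (dscale (1 - t) b)))
    with (dplus (dscale t (dminus u a)) (dscale (1 - t) (dminus u b))) by dual_lin.
  now apply HC.
Qed.

Lemma daffine_comb3 C a b c : daffine C -> C a -> C b -> C c -> C (dplus a (dminus b c)).
Proof.
  intros HC Ha Hb Hc.
  replace (dplus a (dminus b c))
    with (dplus (dscale 2 (dplus (dscale (/ 2) a) (dscale (1 - / 2) b))) (dscale (1 - 2) c))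
    by dual_lin.
  apply HC; auto.
Qed.

(** Links the directions quantified over in [icr] with the affine hull that occurs in [ri]. *)
Lemma aff_diff D u x : D u -> (aff (set_minus D D) x <-> aff D (dplus u x)).
Proof.
  intro Hu; split; intro Hx.
  - apply (Hx (fun x => aff D (dplus u x))).
    + apply daffine_shift, aff_daffine.
    + intros y [a [b [Ha [Hb ->]]]].
      apply daffine_comb3; [apply aff_daffine | | |]; now apply aff_incl.
  - replace x with (dplus (dscale (-1) u) (dplus u x)) by dual_lin.
    apply (Hx (fun y => aff (set_minus D D) (dplus (dscale (-1) u) y))).
    + apply daffine_shift, aff_daffine.
    + intros a Ha. apply aff_incl. exists a, u. repeat split; auto. dual_lin.
Qed.

Lemma aff_diff_subspace D u :
  D u -> subspace (E := dualB X) (aff (set_minus D D)).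
Proof.
  intro Hu.
  assert (H0 : aff (set_minus D D) (dzero X)).
  { apply aff_incl. exists u, u. repeat split; auto. dual_lin. }
  assert (Hs : forall a x, aff (set_minus D D) x -> aff (set_minus D D) (dscale a x)).
  { intros a x Hx. replace (dscale a x) with (dplus (dscale a x) (dscale (1 - a) (dzero X)))
      by dual_lin.
    now apply aff_daffine. }
  split; [exact H0 | split; [|exact Hs]]. intros x y Hx Hy. simpl.
  replace (dplus x y) with (dscale 2 (dplus (dscale (/ 2) x) (dscale (1 - / 2) y))) by dual_lin.
  apply Hs. now apply aff_daffine.
Qed.

Lemma aff_diff_closed D u :
  D u -> dclosed (aff D) -> norm_closed (E := dualB X) (aff (set_minus D D)).
Proof.
  intros Hu Hcl x Hx. apply (proj2 (aff_diff x Hu)), Hcl. intros e He.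
  destruct (Hx e He) as [y [Hy Hyx]]. exists (dplus u y).
  split; [exact (proj1 (aff_diff y Hu) Hy)|].
  replace (dminus (dplus u y) (dplus u x)) with (dminus y x) by dual_lin. exact Hyx.
Qed.

(** An empty [D] has empty affine hulls, and then [ic D] holds vacuously everywhere; hence the
    nonemptiness hypothesis. *)
Lemma ic_mem D u : (exists d, D d) -> ic D u -> D u.
Proof.
  intros [d Hd] [_ H]. destruct (H (dzero X)) as [e [He H1]].
  { apply (aff_diff_subspace Hd). }
  replace u with (dplus u (dscale 0 (dzero X))) by dual_lin. apply H1; lra.
Qed.

(** The two sets have the same affine hull, hence the same directions. The second inclusion may
    assume closedness because the density argument only places [D'] in the closure of [aff D]. *)
Lemma ic_mono D D' u :
  (exists d, D d) -> dsubset D D' -> (dclosed (aff D) -> dsubset D' (aff D)) ->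
  ic D u -> ic D' u.
Proof.
  intros [d0 Hd0] Hsub Hsub' [Hcl Hu]. specialize (Hsub' Hcl).
  assert (Hle : dsubset (aff D') (aff D)) by (apply aff_min; [apply aff_daffine | auto]).
  assert (Hge : dsubset (aff D) (aff D')).
  { apply aff_min; [apply aff_daffine|]. intros x Hx. apply aff_incl; auto. }
  split.
  - intros x Hx. apply Hge, Hcl. intros e He. destruct (Hx e He) as [y [Hy Hyx]].
    exists y; split; auto.
  - intros x Hx. destruct (Hu x) as [d [Hd H]].
    + apply (proj2 (aff_diff x Hd0)), Hle. exact (proj1 (aff_diff x (Hsub _ Hd0)) Hx).
    + exists d; split; auto.
Qed.

Lemma ri_ic D u : ri D u -> ic D u.
Proof.
  intros [Hcl [Hu [e [He H]]]]. split; [auto|]. intros x Hx.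
  exists (e / (dnorm x + 1) / 2). pose proof (dnorm_nonneg x) as Hn.
  assert (Hd : 0 < e / (dnorm x + 1)) by (apply Rdiv_lt_0_compat; lra).
  split; [lra|]. intros l Hl. apply H.
  - apply (proj1 (aff_diff (dscale l x) Hu)). now apply (aff_diff_subspace Hu).
  - replace (dminus (dplus u (dscale l x)) u) with (dscale l x) by dual_lin.
    rewrite dnorm_scale, Rabs_pos_eq by lra.
    assert (Heq : e / (dnorm x + 1) * (dnorm x + 1) = e) by (field; lra). nra.
Qed.

Lemma co_incl A : dsubset A (co A).
Proof. intros a Ha C _ HC; auto. Qed.

Lemma co_diff_aff A B a0 b0 :
  A a0 -> B b0 -> dsubset (set_minus (co A) (co B)) (aff (set_minus A B)).
Proof.
  intros Ha0 Hb0 u [a [b [Ha [Hb ->]]]].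
  apply (Hb (fun b => aff (set_minus A B) (dminus a b))).
  - apply daffine_dconvex, daffine_reflect, aff_daffine.
  - intros b' Hb'.
    replace (dminus a b') with (dplus (dscale (-1) b') a) by dual_lin.
    apply (Ha (fun a => aff (set_minus A B) (dplus (dscale (-1) b') a))).
    + apply daffine_dconvex, daffine_shift, aff_daffine.
    + intros a' Ha'. apply aff_incl. exists a', b'. repeat split; auto. dual_lin.
Qed.

End Affine.

(** * Representative functions and the parallel sum *)

Lemma convex_lt a b e t : a < e -> b < e -> 0 <= t <= 1 -> t * a + (1 - t) * b < e.
Proof.
  intros Ha Hb Ht. destruct (Req_dec t 0) as [->|H0]; [lra|].
  pose proof (Rmult_lt_compat_l t a e ltac:(lra) Ha).
  pose proof (Rmult_le_compat_l (1 - t) b e ltac:(lra) ltac:(lra)). lra.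
Qed.

Section Parallel.
Variable X : Banach.

Definition epi (h : xfun X) (x : X) (xs : dual X) (r : R) : Prop := ERle (h x xs) (Fin r).

Definition epi_pr (C : X -> dual X -> R -> Prop) : dset X := fun xs => exists x r, C x xs r.

Lemma pr_dom_epi h xs : pr_dom h xs <-> epi_pr (epi h) xs.
Proof.
  unfold epi_pr, epi; split; intros [x [r H]]; exists x.
  - exists r. rewrite H; simpl; lra.
  - destruct (h x xs) as [a|]; [now exists a | easy].
Qed.

Lemma strong_rep_epi S h : strong_rep S h -> strong_epi (epi h).
Proof.
  intros [[Hconv [Hlsc [Hge _]]] Hconj]. split.
  - intros x xs r y ys q t Hx Hy Ht. unfold epi in *.
    destruct (h x xs) as [a|] eqn:Ea; [|easy]. destruct (h y ys) as [b|] eqn:Eb; [|easy].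
    simpl in Hx, Hy. pose proof (Hconv _ _ _ _ _ _ _ Ea Eb Ht) as H.
    destruct (h (badd (bscal t x) (bscal (1 - t) y))) as [c|]; [|easy]. simpl in *.
    pose proof (Rmult_le_compat_l t _ _ ltac:(lra) Hx).
    pose proof (Rmult_le_compat_l (1 - t) _ _ ltac:(lra) Hy). lra.
  - intros x xs r H. unfold epi in *. apply NNPP; intro Hn.
    assert (Hr : exists r', r < r' /\ ERlt (Fin r') (h x xs)).
    { destruct (h x xs) as [a|]; simpl in *.
      - exists ((r + a) / 2). apply Rnot_le_lt in Hn. lra.
      - exists (r + 1); split; [lra | easy]. }
    destruct Hr as [r' [Hr' Hlt]]. destruct (Hlsc _ _ _ Hlt) as [d [Hd Hnear]].
    destruct (H (Rmin (d / 2) (r' - r))) as [y [ys [q [Hq [H1 [H2 H3]]]]]].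
    { apply Rmin_glb_lt; lra. }
    pose proof (Rmin_l (d / 2) (r' - r)); pose proof (Rmin_r (d / 2) (r' - r)).
    specialize (Hnear y ys ltac:(lra)). pose proof (Rle_abs (q - r)).
    destruct (h y ys) as [a|]; simpl in *; [lra | easy].
  - intros x xs r H. unfold epi in H. specialize (Hge x xs).
    destruct (h x xs) as [a|]; simpl in *; [lra | easy].
  - intros xs xss b Hb. destruct (Hconj xs xss b Hb) as [x [ys [r [Hr Hbr]]]].
    exists x, ys, r. split; [unfold epi; rewrite Hr; simpl; lra | auto].
Qed.

(** A representative function only guarantees that the graph consists of contact points; the
    converse is the maximality of [S]. *)
Lemma strong_rep_contact S h x xs :
  maximal_monotone S -> strong_rep S h -> (S x xs <-> contact (epi h) x xs).
Proof.
  intros [_ Hmax] Hh.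
  assert (Hsub : forall x xs, S x xs -> contact (epi h) x xs).
  { intros y ys Hy. unfold contact, epi.
    destruct Hh as [[_ [_ [_ H]]] _]. rewrite (H _ _ Hy). simpl; lra. }
  split; [apply Hsub|]. apply (Hmax _ (contact_monotone (strong_rep_epi Hh)) Hsub).
Qed.

Lemma contact_nonempty (C : X -> dual X -> R -> Prop) :
  strong_epi C -> exists x xs, contact C x xs.
Proof.
  intro HC. destruct (@contact_conj X C (dzero X) (J bzero) (-1) HC) as [x [xs [H _]]].
  - simpl; lra.
  - now exists x, xs.
Qed.

(** [broendsted_rockafellar] with [b] small and [a] as large as the gap requires: the first variable
    may move far. *)
Lemma epi_pr_range_closure (C : X -> dual X -> R -> Prop) xs e :
  strong_epi C -> epi_pr C xs -> 0 < e ->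
  exists y ys, contact C y ys /\ dnorm (dminus ys xs) < e.
Proof.
  intros HC [x [r Hx]] He.
  pose (b := e / 7). assert (Hb : 0 < b) by (unfold b; lra).
  pose proof (epi_ge HC Hx) as Hge.
  pose (a := (r - xs x + 1) / b). assert (Ha : 0 < a) by (apply Rdiv_lt_0_compat; lra).
  destruct (@broendsted_rockafellar X C x xs r a b HC Ha Hb Hx) as [y [ys [Hy [_ H2]]]].
  - unfold a. replace ((r - xs x + 1) / b * b) with (r - xs x + 1) by (field; lra). lra.
  - exists y, ys. split; [auto | unfold b in *; lra].
Qed.

Lemma epi_pr_convex (C : X -> dual X -> R -> Prop) : pair_convex C -> dconvex (epi_pr C).
Proof.
  intros HC a b t [x [r Hx]] [y [q Hy]] Ht. eexists _, _. now apply HC; eauto.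
Qed.

(* Robinson-Ursescu for the projection [((x, xs, r), (y, ys, q)) |-> xs - ys] of the
   product of the two epigraphs. *)
Lemma epi_pr_lift (C1 C2 : X -> dual X -> R -> Prop) u :
  strong_epi C1 -> strong_epi C2 ->
  let D := set_minus (epi_pr C1) (epi_pr C2) in
  ic D u ->
  exists rho N, 0 < rho /\ forall v, aff (set_minus D D) v -> dnorm v <= rho ->
    exists x xs r y ys q, C1 x xs r /\ C2 y ys q /\ dminus xs ys = dplus u v /\
      bnorm x <= N /\ dnorm xs <= N /\ r <= N /\ bnorm y <= N /\ dnorm ys <= N /\ q <= N.
Proof.
  intros HC1 HC2 D Hu.
  assert (HDne : exists d, D d).
  { destruct (contact_nonempty HC1) as [x [xs Hx]]. destruct (contact_nonempty HC2) as [y [ys Hy]].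
    exists (dminus xs ys), xs, ys. repeat split; [now exists x, (xs x) | now exists y, (ys y)]. }
  pose proof (ic_mem HDne Hu) as HDu.
  pose (E := prodB (prodB X (dualB X)) RB).
  pose (p := fun z : prodB E E => dminus (snd (fst (fst z))) (snd (fst (snd z))) : dualB X).
  pose (inC := fun (C : X -> dual X -> R -> Prop) (z : E) => C (fst (fst z)) (snd (fst z)) (snd z)).
  assert (Hcl : forall C, strong_epi C -> norm_closed (E := E) (inC C)).
  { intros C HC [[x xs] r] H. apply (epi_closed HC). intros e He.
    destruct (H e He) as [[[y ys] q] [Hy Hd]]. exists y, ys, q. split; [exact Hy|].
    simpl in Hd. fold (bminus y x) in Hd. fold (dminus ys xs) in Hd.
    pose proof (bnorm_nonneg (bminus y x)). pose proof (dnorm_nonneg (dminus ys xs)).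
    pose proof (Rabs_pos (q + - r)). simpl. unfold Rminus. repeat split; lra. }
  destruct (@robinson_ursescu (prodB E E) (dualB X) p (fun z => inC C1 (fst z) /\ inC C2 (snd z))
    (aff (set_minus D D)) u) as [rho [N [Hrho HN]]].
  - split; [|split].
    + intros [[[x xs] r] [[y ys] q]] [[[x' xs'] r'] [[y' ys'] q']]. unfold p; simpl. dual_lin.
    + intros a [[[x xs] r] [[y ys] q]]. unfold p; simpl. dual_lin.
    + exists 1; split; [lra|]. intros [[[x xs] r] [[y ys] q]]. unfold p; simpl.
      pose proof (dnorm_triangle xs (dscale (-1) ys)) as H.
      rewrite dnorm_scale, (Rabs_left (-1)) in H by lra. unfold dminus.
      pose proof (bnorm_nonneg x). pose proof (bnorm_nonneg y).
      pose proof (Rabs_pos r). pose proof (Rabs_pos q). lra.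
  - intros [[[x xs] r] [[y ys] q]] [[[x' xs'] r'] [[y' ys'] q']] t [H1 H2] [H3 H4] Ht.
    split; [exact (epi_convex HC1 H1 H3 Ht) | exact (epi_convex HC2 H2 H4 Ht)].
  - intros [z1 z2] H. split; [apply (Hcl C1 HC1) | apply (Hcl C2 HC2)];
      intros e He; destruct (H e He) as [[y1 y2] [[H1 H2] Hd]];
      change (bnorm (bminus (X := E) y1 z1) + bnorm (bminus (X := E) y2 z2) < e) in Hd;
      pose proof (bnorm_nonneg (bminus (X := E) y1 z1));
      pose proof (bnorm_nonneg (bminus (X := E) y2 z2)).
    + exists y1; split; [exact H1 | simpl fst in *; lra].
    + exists y2; split; [exact H2 | simpl snd in *; lra].
  - exact (aff_diff_subspace HDu).
  - exact (aff_diff_closed HDu (proj1 Hu)).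
  - intros [[[x xs] r] [[y ys] q]] [H1 H2]. apply aff_incl. unfold p; simpl.
    exists (dminus xs ys), u. repeat split; auto.
    exists xs, ys. repeat split; [now exists x, r | now exists y, q].
  - intros v Hv. destruct (proj2 Hu v Hv) as [d [Hd H]]. exists d; split; [auto|].
    intros l Hl. destruct (H l Hl) as [xs [ys [[x [r Hx]] [[y [q Hy]] Heq]]]].
    exists (((x, xs), r), ((y, ys), q)). split; [now split|]. unfold p; simpl. now rewrite <- Heq.
  - exists rho, N. split; [auto|]. intros v Hv Hvr.
    destruct (HN v Hv Hvr) as [[[[x xs] r] [[y ys] q]] [[H1 H2] [Hn Hp]]].
    exists x, xs, r, y, ys, q. simpl in Hn.
    pose proof (bnorm_nonneg x). pose proof (bnorm_nonneg y).
    pose proof (dnorm_nonneg xs). pose proof (dnorm_nonneg ys).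
    pose proof (Rle_abs r). pose proof (Rle_abs q). pose proof (Rabs_pos r). pose proof (Rabs_pos q).
    repeat split; auto; lra.
Qed.

Lemma ic_epi_pr_ri (C1 C2 : X -> dual X -> R -> Prop) u :
  strong_epi C1 -> strong_epi C2 ->
  ic (set_minus (epi_pr C1) (epi_pr C2)) u -> ri (set_minus (epi_pr C1) (epi_pr C2)) u.
Proof.
  intros HC1 HC2 Hu. pose proof (epi_pr_lift HC1 HC2 Hu) as [rho [N [Hrho HN]]].
  assert (HDu : set_minus (epi_pr C1) (epi_pr C2) u).
  { apply ic_mem; auto.
    destruct (contact_nonempty HC1) as [x [xs Hx]]. destruct (contact_nonempty HC2) as [y [ys Hy]].
    exists (dminus xs ys), xs, ys. repeat split; [now exists x, (xs x) | now exists y, (ys y)]. }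
  split; [apply Hu | split; [auto|]]. exists rho; split; [auto|]. intros v Hv Hvu.
  destruct (HN (dminus v u)) as [x [xs [r [y [ys [q [H1 [H2 [Heq _]]]]]]]]].
  - apply (proj2 (aff_diff _ HDu)). replace (dplus u (dminus v u)) with v by dual_lin. exact Hv.
  - lra.
  - exists xs, ys. split; [now exists x, r | split; [now exists y, q|]].
    rewrite Heq. dual_lin.
Qed.

(* Attouch-Brezis duality: the value function [v] of the perturbation [u = ys - zs] is
   bounded above on a ball of the closed subspace spanned by its domain, hence
   [v u >= - b - k |u|] everywhere, and its subgradient at 0 splits [xss]. *)
Lemma conj_splitting (C1 C2 : X -> dual X -> R -> Prop) (xs : dual X) (xss : bidual X) b :
  strong_epi C1 -> strong_epi C2 -> ic (set_minus (epi_pr C1) (epi_pr C2)) (dzero X) ->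
  (forall x y ys r q, C1 x ys r -> C2 y ys q -> xs (badd x y) + xss ys - r - q <= b) ->
  exists A B : bidual X, bplus A B = xss /\
    forall x ys r y zs q, C1 x ys r -> C2 y zs q ->
      (xs x + A ys - r) + (xs y + B zs - q) <= b.
Proof.
  intros HC1 HC2 Hic Hb.
  destruct (epi_pr_lift HC1 HC2 Hic) as [rho [N [Hrho HN]]].
  assert (HD0 : set_minus (epi_pr C1) (epi_pr C2) (dzero X)).
  { apply (ic_epi_pr_ri HC1 HC2 Hic). }
  pose proof (aff_diff_subspace HD0) as [HL0 [HLa HLs]]. simpl in HL0, HLa, HLs.
  pose (V := fun (u : dualB X) (t : R) => exists x ys r y zs q,
    C1 x ys r /\ C2 y zs q /\ u = dminus ys zs /\ t = r + q - xs (badd x y) - xss ys + b).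
  assert (HVconv : convex_epi V).
  { intros u v t t' l [x [ys [r [y [zs [q [H1 [H2 [-> ->]]]]]]]]]
      [x' [ys' [r' [y' [zs' [q' [H1' [H2' [-> ->]]]]]]]]] Hl.
    eexists _, _, _, _, _, _.
    split; [exact (epi_convex HC1 H1 H1' Hl) | split; [exact (epi_convex HC2 H2 H2' Hl) | split]].
    - simpl. dual_lin.
    - rewrite !dapp_add, !dapp_scal, bdapp_add, !bdapp_scal. ring. }
  assert (HV0 : forall t, V (dzero X) t -> 0 <= t).
  { intros t [x [ys [r [y [zs [q [H1 [H2 [H0 ->]]]]]]]]].
    assert (ys = zs).
    { replace ys with (dplus zs (dminus ys zs)) by dual_lin. rewrite <- H0. dual_lin. }
    subst zs. specialize (Hb _ _ _ _ _ H1 H2). lra. }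
  assert (Hup : exists P, 0 <= P /\ forall v, aff (set_minus (set_minus (epi_pr C1) (epi_pr C2))
       (set_minus (epi_pr C1) (epi_pr C2))) v -> dnorm v <= rho -> exists t, V v t /\ t <= P).
  { destruct (bdapp_bound xss) as [K [HK Hxss]].
    exists (Rmax 0 (2 * N + dnorm xs * (2 * N) + K * N + b)). split; [apply Rmax_l|].
    intros v Hv Hvr. destruct (HN v Hv Hvr)
      as [x [ys [r [y [zs [q [H1 [H2 [Heq [B1 [B2 [B3 [B4 [B5 B6]]]]]]]]]]]]]].
    exists (r + q - xs (badd x y) - xss ys + b). split.
    - exists x, ys, r, y, zs, q. repeat split; auto. rewrite Heq. dual_lin.
    - eapply Rle_trans; [|apply Rmax_r].
      assert (A1 : Rabs (xs (badd x y)) <= dnorm xs * (2 * N)).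
      { apply dapp_le_norms; [lra|]. pose proof (bnorm_triangle x y); lra. }
      assert (A2 : Rabs (xss ys) <= K * N).
      { eapply Rle_trans; [apply Hxss|]. now apply Rmult_le_compat_l. }
      pose proof (Rle_abs (- xs (badd x y))) as A3. pose proof (Rle_abs (- xss ys)) as A4.
      rewrite Rabs_Ropp in A3, A4. lra. }
  destruct Hup as [P [HP Hup]].
  assert (HVaff : forall u t, V u t -> aff (set_minus (set_minus (epi_pr C1) (epi_pr C2))
       (set_minus (epi_pr C1) (epi_pr C2))) u).
  { intros u t [x [ys [r [y [zs [q [H1 [H2 [-> ->]]]]]]]]]. apply (proj2 (aff_diff _ HD0)).
    apply aff_incl. exists ys, zs. split; [now exists x, r | split; [now exists y, q|]]. dual_lin. }
  pose (k := P / rho).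
  assert (HVlow : forall u t, V u t -> 0 <= t + k * dnorm u).
  { intros u t Hu. destruct (Req_dec (dnorm u) 0) as [H0|H0].
    - apply dnorm_eq0 in H0. subst u. specialize (HV0 t Hu).
      assert (dnorm (dzero X) = 0) by exact (bnorm_0 (dualB X)). rewrite H; lra.
    - assert (Hn : 0 < dnorm u) by (pose proof (dnorm_nonneg u); lra).
      set (n := dnorm u) in *.
      destruct (Hup (dscale (- (rho / n)) u)) as [t' [Ht' HtP]].
      { apply HLs. eapply HVaff; eauto. }
      { rewrite dnorm_scale, Rabs_Ropp, Rabs_pos_eq by (apply Rlt_le, Rdiv_lt_0_compat; lra).
        fold n. right; field; lra. }
      (* The point over [u] is mixed with one over the opposite vector of norm [rho], whose value is
         at most [P]. The mixture lies over 0, where values are nonnegative; solving for [t] gives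
         the slope [k = P / rho]. *)
      pose (l := rho / (rho + n)).
      assert (Hl : 0 <= l <= 1).
      { split; [apply Rlt_le, Rdiv_lt_0_compat; lra|].
        apply Rmult_le_reg_r with (rho + n); [lra|].
        unfold l, Rdiv; rewrite Rmult_assoc, Rinv_l by lra. lra. }
      pose proof (HVconv _ _ _ _ l Hu Ht' Hl) as Hc. simpl in Hc.
      replace (dplus (dscale l u) (dscale (1 - l) (dscale (- (rho / n)) u))) with (dzero X) in Hc
        by (unfold l; dual_lin).
      specialize (HV0 _ Hc).
      assert (Hc2 : 0 <= l * t + (1 - l) * P) by nra.
      apply (Rmult_le_compat_l ((rho + n) / rho)) in Hc2;
        [|apply Rlt_le, Rdiv_lt_0_compat; lra].
      unfold k. replace (t + P / rho * n) with ((rho + n) / rho * (l * t + (1 - l) * P))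
        by (unfold l; field; lra). lra. }
  destruct (Hup (dzero X) HL0) as [t0 [Ht0 _]].
  { assert (H : dnorm (dzero X) = 0) by exact (bnorm_0 (dualB X)). rewrite H; lra. }
  assert (Hk : 0 <= k) by (unfold k; apply Rmult_le_pos; [auto | apply Rlt_le, Rinv_0_lt_compat; auto]).
  (* [V] lives on a subspace only. Separating it from [k * dnorm u], finite everywhere, yields a
     continuous functional on the whole dual. *)
  destruct (@sandwich (dualB X) V (fun u => k * dnorm u) (dzero X) t0 k) as [l Hl]; auto.
  - intros x y t Ht. pose proof (bnorm_comb (E := dualB X) x y Ht) as H.
    apply (Rmult_le_compat_l k) in H; [|auto]. simpl in *. lra.
  - intros y Hy. replace (bminus (y : dualB X) (dzero X)) with y in Hy by (symmetry; simpl; dual_lin).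
    simpl in Hy. nra.
  - exists (bplus xss (bidual_of (dscale (-1) l))), (bidual_of l). split.
    + apply bidual_ext; intro f; simpl. ring.
    + intros x ys r y zs q H1 H2.
      specialize (Hl (dminus ys zs) (r + q - xs (badd x y) - xss ys + b) (dzero X)).
      assert (Hd : l (dminus ys zs : dualB X) = l ys - l zs) by exact (bdapp_minus (bidual_of l) ys zs).
      assert (Hz : l (dzero X : dualB X) = 0) by exact (dapp_0 l).
      assert (Hn : dnorm (dzero X) = 0) by exact (bnorm_0 (dualB X)).
      rewrite Hd, Hz, Hn, dapp_add in Hl. simpl.
      assert (Hv : V (dminus ys zs) (r + q - (xs x + xs y) - xss ys + b)).
      { exists x, ys, r, y, zs, q. repeat split; auto. now rewrite dapp_add. }
      specialize (Hl Hv). lra.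
Qed.

(** Type (D) replaces [(a, xs)] by graph points, to which [(b, ys)] is related by definition.
    Boundedness of the net lets the coupling pass to the limit. *)
Lemma gossez_monotone (S : multifun X) (a b : bidual X) xs ys :
  gossez_D S -> gossez S a xs -> gossez S b ys -> 0 <= a (dminus xs ys) - b (dminus xs ys).
Proof.
  intros [_ HD] Ha Hb.
  destruct (HD a xs Ha) as [I [le [x [zs [[_ [_ [_ Hdir]]] [HS [[M HM] [Hw Hn]]]]]]]].
  destruct (bdapp_bound b) as [K [HK Hbn]].
  apply le_epsilon; intros e He.
  assert (HM0 : exists M', 0 <= M' /\ forall i, bnorm (x i) <= M').
  { exists (Rabs M). split; [apply Rabs_pos|]. intro i.
    pose proof (proj1 (HM i)). pose proof (Rle_abs M). lra. }
  destruct HM0 as [M' [HM'0 HM']].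
  pose (d := e / (K + M' + 2)). assert (Hd : 0 < d) by (apply Rdiv_lt_0_compat; lra).
  assert (Hde : d * (K + M' + 2) = e) by (unfold d; field; lra).
  destruct (Hw (dminus xs ys) d Hd) as [i1 H1]. destruct (Hn d Hd) as [i2 H2].
  destruct (Hdir i1 i2) as [i [Hi1 Hi2]]. specialize (H1 i Hi1). specialize (H2 i Hi2).
  rewrite Rminus_0_r, Rabs_pos_eq in H2 by apply dnorm_nonneg.
  specialize (Hb _ _ (HS i)).
  pose proof (Hbn (dminus (zs i) xs)) as H3.
  assert (H4 : Rabs (dminus (zs i) xs (x i)) <= d * M') by (apply dapp_le_norms; [lra | auto]).
  rewrite !bdapp_minus in *. rewrite !dminus_app in *.
  pose proof (Rle_abs (xs (x i) - ys (x i) - (a xs - a ys))).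
  pose proof (Rle_abs (- (xs (x i) - ys (x i) - (a xs - a ys)))) as G1. rewrite Rabs_Ropp in G1.
  pose proof (Rle_abs (b (zs i) - b xs)).
  pose proof (Rle_abs (- (b (zs i) - b xs))) as G2. rewrite Rabs_Ropp in G2.
  pose proof (Rle_abs (zs i (x i) - xs (x i))).
  pose proof (Rle_abs (- (zs i (x i) - xs (x i)))) as G3. rewrite Rabs_Ropp in G3.
  assert (K * dnorm (dminus (zs i) xs) <= K * d) by (apply Rmult_le_compat_l; lra).
  lra.
Qed.

Lemma parallel_sum_monotone (S T : multifun X) :
  gossez_D S -> gossez_D T -> monotone (parallel_sum S T).
Proof.
  intros HS HT x xs y ys [a [b [Ha [Hb Hab]]]] [c [d [Hc [Hd Hcd]]]].
  rewrite dapp_minus.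
  change (0 <= J x (dminus xs ys) - J y (dminus xs ys)). rewrite Hab, Hcd. simpl (bplus _ _ _).
  pose proof (gossez_monotone HS Ha Hc). pose proof (gossez_monotone HT Hb Hd). lra.
Qed.

(** The closure is built in, since an inf-convolution of closed functions need be neither closed nor
    attained. *)
Definition inf_conv (C1 C2 : X -> dual X -> R -> Prop) (x : X) (xs : dual X) (r : R) : Prop :=
  forall e, 0 < e -> exists a b ys p q, C1 a ys p /\ C2 b ys q /\
    bnorm (bminus (badd a b) x) < e /\ dnorm (dminus ys xs) < e /\ Rabs (p + q - r) < e.

Lemma inf_conv_incl (C1 C2 : X -> dual X -> R -> Prop) a b xs p q :
  C1 a xs p -> C2 b xs q -> inf_conv C1 C2 (badd a b) xs (p + q).
Proof.
  intros H1 H2 e He. exists a, b, xs, p, q. repeat split; auto.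
  - rewrite bminus_diag_norm; lra.
  - assert (H : dnorm (dminus xs xs) = 0) by exact (bminus_diag_norm (xs : dualB X)).
    rewrite H; lra.
  - rewrite Rminus_diag, Rabs_R0; lra.
Qed.

Lemma inf_conv_strong (C1 C2 : X -> dual X -> R -> Prop) :
  strong_epi C1 -> strong_epi C2 -> ic (set_minus (epi_pr C1) (epi_pr C2)) (dzero X) ->
  strong_epi (inf_conv C1 C2).
Proof.
  intros HC1 HC2 Hic. split.
  - intros x xs r y ys q t Hx Hy Ht e He.
    destruct (Hx e He) as [a [b [vs [p [p' [H1 [H2 [B1 [B2 B3]]]]]]]]].
    destruct (Hy e He) as [c [d [ws [s [s' [H3 [H4 [B4 [B5 B6]]]]]]]]].
    eexists _, _, _, _, _. split; [exact (epi_convex HC1 H1 H3 Ht)|].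
    split; [exact (epi_convex HC2 H2 H4 Ht)|]. split; [|split].
    + replace (bminus (badd (badd (bscal t a) (bscal (1 - t) c)) (badd (bscal t b) (bscal (1 - t) d)))
        (badd (bscal t x) (bscal (1 - t) y)))
        with (badd (bscal t (bminus (badd a b) x)) (bscal (1 - t) (bminus (badd c d) y))) by vec.
      eapply Rle_lt_trans; [now apply bnorm_comb|]. now apply convex_lt.
    + replace (dminus (dplus (dscale t vs) (dscale (1 - t) ws)) (dplus (dscale t xs) (dscale (1 - t) ys)))
        with (dplus (dscale t (dminus vs xs)) (dscale (1 - t) (dminus ws ys))) by dual_lin.
      eapply Rle_lt_trans; [exact (bnorm_comb (E := dualB X) (dminus vs xs) (dminus ws ys) Ht)|].
      now apply convex_lt.
    + replace (t * p + (1 - t) * s + (t * p' + (1 - t) * s') - (t * r + (1 - t) * q))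
        with (t * (p + p' - r) + (1 - t) * (s + s' - q)) by ring.
      eapply Rle_lt_trans; [apply Rabs_triang|].
      rewrite !Rabs_mult, (Rabs_pos_eq t), (Rabs_pos_eq (1 - t)) by lra. now apply convex_lt.
  - intros x xs r H e He. destruct (H (e / 2)) as [y [ys [q [Hy [B1 [B2 B3]]]]]]; [lra|].
    destruct (Hy (e / 2)) as [a [b [zs [p [p' [H1 [H2 [B4 [B5 B6]]]]]]]]]; [lra|].
    exists a, b, zs, p, p'. repeat split; auto.
    + pose proof (bnorm_minus_triangle y (badd a b) x); lra.
    + pose proof (dnorm_minus_triangle ys zs xs); lra.
    + pose proof (Rabs_triang (p + p' - q) (q - r)).
      replace (p + p' - q + (q - r)) with (p + p' - r) in H0 by ring. lra.
  - intros x xs r H. apply le_of_le_linear with (bnorm x + 1 + dnorm xs + 1). intros e He.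
    destruct (H e ltac:(lra)) as [a [b [ys [p [q [H1 [H2 [B1 [B2 B3]]]]]]]]].
    pose proof (epi_ge HC1 H1). pose proof (epi_ge HC2 H2).
    pose proof (bnorm_le_minus (badd a b) x) as Hn.
    assert (A1 : Rabs (dminus ys xs (badd a b)) <= e * (bnorm x + 1)) by (apply dapp_le_norms; lra).
    assert (A2 : Rabs (xs (bminus (badd a b) x)) <= dnorm xs * e) by (apply dapp_le_norms; lra).
    rewrite dminus_app in A1. rewrite dapp_minus in A2. rewrite !dapp_add in *.
    pose proof (Rle_abs (- (ys a + ys b - (xs a + xs b)))) as A3.
    pose proof (Rle_abs (- (xs a + xs b - xs x))) as A4. rewrite Rabs_Ropp in A3, A4.
    pose proof (Rle_abs (p + q - r)). lra.
  - intros xs xss b Hb. apply NNPP; intro Hn.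
    destruct (@conj_splitting C1 C2 xs xss b HC1 HC2 Hic) as [A [B [HAB Hsplit]]].
    { intros x y ys r q H1 H2. apply Rnot_lt_le; intro Hlt. apply Hn.
      exists (badd x y), ys, (r + q). split; [now apply inf_conv_incl | lra]. }
    assert (Hxss : A xs + B xs = xss xs) by now rewrite <- HAB.
    (* Half the gap for each summand: two values within [d] of [A xs] and [B xs] already add up to
       more than [b]. *)
    pose (d := (xss xs - b) / 2). assert (Hd : 0 < d) by (unfold d; lra).
    destruct (epi_conj HC1 (xs := xs) (xss := A) (b := A xs - d)) as [x [ys [r [H1 H1']]]]; [lra|].
    destruct (epi_conj HC2 (xs := xs) (xss := B) (b := B xs - d)) as [y [zs [q [H2 H2']]]]; [lra|].
    specialize (Hsplit _ _ _ _ _ _ H1 H2). unfold d in *. lra.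
Qed.

Lemma gossez_of_conj_le C (S : multifun X) (a : bidual X) (xs : dual X) :
  (forall y ys, S y ys -> contact C y ys) ->
  (forall y ys r, C y ys r -> xs y + a ys - r <= a xs) -> gossez S a xs.
Proof.
  intros HS H y ys Hy. specialize (H _ _ _ (HS _ _ Hy)).
  rewrite bdapp_minus, dminus_app. lra.
Qed.

(** At a contact point the conjugate at [(xs, J x)] is at most the coupling. The conjugates at
    [(xs, A)] and [(xs, B)] are at least [A xs] and [B xs] and together at most the sum of these, so
    both are equalities, which place [A] and [B] in the Gossez closures. *)
Lemma contact_inf_conv_parallel (C1 C2 : X -> dual X -> R -> Prop) (S T : multifun X) x xs :
  strong_epi C1 -> strong_epi C2 -> ic (set_minus (epi_pr C1) (epi_pr C2)) (dzero X) ->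
  (forall y ys, S y ys -> contact C1 y ys) -> (forall y ys, T y ys -> contact C2 y ys) ->
  contact (inf_conv C1 C2) x xs -> parallel_sum S T x xs.
Proof.
  intros HC1 HC2 Hic HS HT Hx.
  destruct (@conj_splitting C1 C2 xs (J x) (xs x) HC1 HC2 Hic) as [A [B [HAB Hsplit]]].
  { intros a b ys r q H1 H2.
    pose proof (contact_subgradient (inf_conv_strong HC1 HC2 Hic) Hx (inf_conv_incl H1 H2)) as H.
    simpl. lra. }
  assert (Hsum : A xs + B xs = xs x) by (change (bplus A B xs = J x xs); now rewrite HAB).
  exists A, B. split; [|split; [|now symmetry]].
  - apply (gossez_of_conj_le HS). intros y ys r Hy. apply le_epsilon; intros e He.
    destruct (epi_conj HC2 (xs := xs) (xss := B) (b := B xs - e)) as [z [zs [q [Hz Hq]]]]; [lra|].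
    specialize (Hsplit _ _ _ _ _ _ Hy Hz). lra.
  - apply (gossez_of_conj_le HT). intros y ys r Hy. apply le_epsilon; intros e He.
    destruct (epi_conj HC1 (xs := xs) (xss := A) (b := A xs - e)) as [z [zs [q [Hz Hq]]]]; [lra|].
    specialize (Hsplit _ _ _ _ _ _ Hz Hy). lra.
Qed.

Lemma multifun_ext (S T : multifun X) : (forall x xs, S x xs <-> T x xs) -> S = T.
Proof.
  intro H. apply functional_extensionality; intro x. apply functional_extensionality; intro xs.
  now apply propositional_extensionality.
Qed.

Lemma parallel_sum_gossez_D (C1 C2 : X -> dual X -> R -> Prop) :
  strong_epi C1 -> strong_epi C2 -> ic (set_minus (epi_pr C1) (epi_pr C2)) (dzero X) ->
  gossez_D (parallel_sum (contact C1) (contact C2)).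
Proof.
  intros HC1 HC2 Hic. pose proof (inf_conv_strong HC1 HC2 Hic) as HC.
  replace (parallel_sum (contact C1) (contact C2)) with (contact (inf_conv C1 C2)).
  { now apply contact_gossez_D. }
  assert (Hsub : forall x xs, contact (inf_conv C1 C2) x xs ->
            parallel_sum (contact C1) (contact C2) x xs).
  { intros x xs. apply contact_inf_conv_parallel; auto. }
  apply multifun_ext. intros x xs; split; [apply Hsub|].
  (* The reverse inclusion: the parallel sum is a monotone extension of a maximal contact set. *)
  apply (proj2 (contact_maximal HC) (parallel_sum (contact C1) (contact C2))); auto.
  apply parallel_sum_monotone; now apply contact_gossez_D.
Qed.

(** The projection of an epigraph contains the convex hull of the range and lies in the closure of
    the range, so closedness of the smaller affine hull makes it contain the larger difference
    set. *)
Lemma ic_co_range_epi_pr (C1 C2 : X -> dual X -> R -> Prop) u :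
  strong_epi C1 -> strong_epi C2 ->
  ic (set_minus (co (range (contact C1))) (co (range (contact C2)))) u ->
  ic (set_minus (epi_pr C1) (epi_pr C2)) u.
Proof.
  intros HC1 HC2.
  assert (Hco : forall C, strong_epi C -> dsubset (co (range (contact C))) (epi_pr C)).
  { intros C HC xs Hxs. apply Hxs; [apply epi_pr_convex, HC|].
    intros ys [y Hy]. now exists y, (ys y). }
  apply ic_mono.
  - destruct (contact_nonempty HC1) as [x [xs Hx]]. destruct (contact_nonempty HC2) as [y [ys Hy]].
    exists (dminus xs ys), xs, ys. repeat split; apply co_incl; [now exists x | now exists y].
  - intros v [xs [ys [Hx [Hy ->]]]]. exists xs, ys. repeat split; [now apply Hco | now apply Hco].
  - intros Hcl v [xs [ys [Hx [Hy ->]]]]. apply Hcl. intros e He.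
    destruct (epi_pr_range_closure (e := e / 2) HC1 Hx) as [a [vs [Ha Hva]]]; [lra|].
    destruct (epi_pr_range_closure (e := e / 2) HC2 Hy) as [b [ws [Hb Hwb]]]; [lra|].
    exists (dminus vs ws). split.
    + apply aff_incl. exists vs, ws. repeat split; apply co_incl; [now exists a | now exists b].
    + replace (dminus (dminus vs ws) (dminus xs ys))
        with (dplus (dminus vs xs) (dscale (-1) (dminus ws ys))) by dual_lin.
      eapply Rle_lt_trans; [apply dnorm_triangle|].
      rewrite dnorm_scale, (Rabs_left (-1)) by lra. lra.
Qed.

End Parallel.

Theorem theorem4p2 (X : Banach) (S T : multifun X) (hS hT : xfun X) :
  (exists x : X, x <> bzero) ->
  gossez_D S -> gossez_D T ->
  strong_rep S hS -> strong_rep T hT ->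
  (exists xs, pr_dom hS xs /\ pr_dom hT xs) ->
  (dsubset (ic (set_minus (range S) (range T)))
           (ic (set_minus (co (range S)) (co (range T)))) /\
   dsubset (ic (set_minus (co (range S)) (co (range T))))
           (ic (set_minus (pr_dom hS) (pr_dom hT))) /\
   (forall u, ic (set_minus (pr_dom hS) (pr_dom hT)) u <->
              ri (set_minus (pr_dom hS) (pr_dom hT)) u)) /\
  (ic (set_minus (range S) (range T)) (dzero X) \/
   ic (set_minus (co (range S)) (co (range T))) (dzero X) ->
   gossez_D (parallel_sum S T)).
Proof.
  intros _ HS HT HhS HhT _.
  pose proof (strong_rep_epi HhS) as HC1. pose proof (strong_rep_epi HhT) as HC2.
  (* From here on both operators are contact sets of strong epigraphs. *)
  replace S with (contact (epi hS)) in *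
    by (apply multifun_ext; intros; symmetry; now apply strong_rep_contact with (1 := proj1 HS)).
  replace T with (contact (epi hT)) in *
    by (apply multifun_ext; intros; symmetry; now apply strong_rep_contact with (1 := proj1 HT)).
  assert (Hpr : forall h : xfun X, pr_dom h = epi_pr (epi h)).
  { intro h. apply functional_extensionality; intro xs.
    apply propositional_extensionality, pr_dom_epi. }
  rewrite !Hpr.
  assert (H1 : dsubset (ic (set_minus (range (contact (epi hS))) (range (contact (epi hT)))))
    (ic (set_minus (co (range (contact (epi hS)))) (co (range (contact (epi hT))))))).
  { destruct (contact_nonempty HC1) as [x [xs Hx]]. destruct (contact_nonempty HC2) as [y [ys Hy]].
    intro u. apply ic_mono.
    - exists (dminus xs ys), xs, ys. repeat split; [now exists x | now exists y].
    - intros v [a [b [Ha [Hb ->]]]]. exists a, b. repeat split; now apply co_incl.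
    - intros _. apply co_diff_aff with xs ys; [now exists x | now exists y]. }
  split; [split; [exact H1 | split]|].
  - intro u. now apply ic_co_range_epi_pr.
  - intro u. split; [now apply ic_epi_pr_ri | apply ri_ic].
  - intro H0. apply parallel_sum_gossez_D; auto. apply ic_co_range_epi_pr; auto.
    destruct H0 as [H0|H0]; [now apply H1 | exact H0].
Qed.
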